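(* For all $n\ge0$, $s,t$, $\xi,\psi$ and $a,b$ the following constraints apply: $$\text{(i)}\quad X_{n,n}+Y_{n,n} = \pi_{n}\eta_{n} = 2n+a+b+1 + \xi s^{a+1}e^{-s}P_{n}(s)Q^{(1)}_{n}(-s) + \psi t^{b+1}e^{-t}P^{(1)}_{n}(-t)Q_{n}(t);$$ \begin{multline*} \text{(ii)}\quad X_{n,n} = \tfrac{S_{n}}{S_{n+1}}\pi_{n+1}\eta_{n} - \tfrac{S_{n-1}}{S_{n}}\pi_{n}\eta_{n-1} - \xi s^{a+1}e^{-s}\Big[ \tfrac{S_{n}}{S_{n+1}}P_{n+1}(s)Q^{(1)}_{n}(-s) - \tfrac{S_{n-1}}{S_{n}}P_{n}(s)Q^{(1)}_{n-1}(-s) \Big]\\ - \psi t^{b+1}e^{-t}\Big[ \tfrac{S_{n}}{S_{n+1}}P^{(1)}_{n+1}(-t)Q_{n}(t) - \tfrac{S_{n-1}}{S_{n}}P^{(1)}_{n}(-t)Q_{n-1}(t) \Big]; \end{multline*} \begin{multline*} \text{(iii)}\quad Y_{n,n} = \tfrac{S_{n}}{S_{n+1}}\pi_{n}\eta_{n+1} - \tfrac{S_{n-1}}{S_{n}}\pi_{n-1}\eta_{n} - \xi s^{a+1}e^{-s}\Big[ \tfrac{S_{n}}{S_{n+1}}P_{n}(s)Q^{(1)}_{n+1}(-s) - \tfrac{S_{n-1}}{S_{n}}P_{n-1}(s)Q^{(1)}_{n}(-s) \Big]\\ - \psi t^{b+1}e^{-t}\Big[ \tfrac{S_{n}}{S_{n+1}}P^{(1)}_{n}(-t)Q_{n+1}(t)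 - \tfrac{S_{n-1}}{S_{n}}P^{(1)}_{n-1}(-t)Q_{n}(t) \Big]; \end{multline*} \begin{multline*} \text{(iv)}\quad X_{n,n} -n-a - \tfrac{S_{n}\eta_{n+1}}{S_{n+1}\eta_{n}} + \tfrac{S_{n-1}\eta_{n-1}}{S_{n}\eta_{n}} + \tfrac{\xi s^{a+1}e^{-s}}{\pi_{n}\eta_{n}}Q^{(1)}_{n}(-s)\Big[ \tfrac{S_{n}}{S_{n+1}}P_{n+1}(s)-(Y_{n,n}+s)P_{n}(s)-\tfrac{S_{n-1}}{S_{n}}P_{n-1}(s) \Big]\\ + \tfrac{\psi t^{b+1}e^{-t}}{\pi_{n}\eta_{n}}Q_{n}(t)\Big[ \tfrac{S_{n}}{S_{n+1}}P^{(1)}_{n+1}(-t)-(Y_{n,n}-t)P^{(1)}_{n}(-t)-\tfrac{S_{n-1}}{S_{n}}P^{(1)}_{n-1}(-t) \Big] = 0; \end{multline*} \begin{multline*} \text{(v)}\quad Y_{n,n} -n-b - \tfrac{S_{n}\pi_{n+1}}{S_{n+1}\pi_{n}} + \tfrac{S_{n-1}\pi_{n-1}}{S_{n}\pi_{n}} + \tfrac{\xi s^{a+1}e^{-s}}{\pi_{n}\eta_{n}}P_{n}(s)\Big[ \tfrac{S_{n}}{S_{n+1}}Q^{(1)}_{n+1}(-s)-(X_{n,n}-s)Q^{(1)}_{n}(-s)-\tfrac{S_{n-1}}{S_{n}}Q^{(1)}_{n-1}(-s) \Big]\\ + \tfrac{\psi t^{b+1}e^{-t}}{\pi_{n}\eta_{n}}P^{(1)}_{n}(-t)\Big[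 \tfrac{S_{n}}{S_{n+1}}Q_{n+1}(t)-(X_{n,n}+t)Q_{n}(t)-\tfrac{S_{n-1}}{S_{n}}Q_{n-1}(t) \Big] = 0. \end{multline*} Not all of these constraints are independent: for example, employing (ii) along with (iii) in (iv), and combining the latter result with (v), directly implies (i). Or alternatively, the system of four relations (ii)–(v), when viewed as a linear inhomogeneous system in $\pi_{n+1},\pi_{n-1},\eta_{n+1},\eta_{n-1}$, has only rank three.
   Context: Let $a,b,\xi,\psi\in\mathbb C$ with $\Re a,\Re b>-1$. For $s,t>0$ put $w_1(x)=(1-\xi\chi_{x>s})x^ae^{-x}$, $w_2(y)=(1-\psi\chi_{y>t})y^be^{-y}$ on $(0,\infty)$, $\langle f,g\rangle=\int_0^\infty\int_0^\infty\frac{w_1(x)w_2(y)}{x+y}f(x)g(y)\,dx\,dy$, $M_{j,k}=\langle x^j,y^k\rangle$, $Z_0=1$, $Z_n=\det(M_{j,k})_{0\le j,k\le n-1}$. $P_n,Q_n$ are polynomials of degree $n$ with the same leading coefficient $S_n$ ($S_n^2=Z_n/Z_{n+1}$) and $\langle P_m,Q_n\rangle=\delta_{m,n}$. $\pi_n=\int_0^\infty w_1P_n\,dx$, $\eta_n=\int_0^\infty w_2Q_n\,dy$, $X_{n,n}=\langle xP_n,Q_n\rangle$, $Y_{n,n}=\langle P_n,yQ_n\rangle$, $P^{(1)}_n(z)=\int_0^\infty\frac{w_1(x)}{z-x}P_n(x)\,dx$, $Q^{(1)}_n(z)=\int_0^\infty\frac{w_2(y)}{z-y}Q_n(y)\,dy$.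 All objects with index $-1$ are $0$. Standing generic conditions: all $M_{j,k}$ finite, $Z_n\ne0$, $\pi_n,\eta_n\ne0$ for all $n\ge0$.
   Formalization: Rank exactly three is claimed only for n≥1 (at n=0, S_{-1}=0 makes the rank 2; rank ≤3 holds for all n), and the algebraic derivation of (i) from (ii)–(v) also uses X_{n,n}+Y_{n,n}=π_nη_n, without which it fails. *)

(* Defs.v *)
From HB Require Import structures.
From mathcomp Require Import all_boot all_order all_algebra.
From mathcomp Require Export complex.
From mathcomp Require Import all_classical all_reals all_analysis.

Set Implicit Arguments.
Unset Strict Implicit.
Unset Printing Implicit Defensive.

Import Order.TTheory GRing.Theory Num.Theory.
Import numFieldNormedType.Exports.

Local Open Scope classical_set_scope.
Local Open Scope ring_scope.
Local Open Scope complex_scope.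

Section complex_integral.
Context (d : measure_display) (T : measurableType d) (R : realType).
Variable mu : {measure set T -> \bar R}.

Definition cintegrable (D : set T) (f : T -> R[i]) : Prop :=
  mu.-integrable D (EFin \o (@complex.Re R \o f)) /\
  mu.-integrable D (EFin \o (@complex.Im R \o f)).

Definition cintegral (D : set T) (f : T -> R[i]) : R[i] :=
  Rintegral mu D (@complex.Re R \o f) +i* Rintegral mu D (@complex.Im R \o f).

End complex_integral.

Section biorthogonal.
Variable R : realType.
Implicit Types (a z xi : R[i]) (s x : R) (n j k : nat) (f g w : R -> R[i]).

(* x ^ a = exp (a ln x), principal branch, meaningful for 0 < x only. *)
Definition cpow x a : R[i] :=
  (x `^ complex.Re a)%:C *
  (cos (complex.Im a * ln x) +i* sin (complex.Im a * ln x)).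

Definition weight xi s a x : R[i] :=
  (1 - xi * (s < x)%R%:R) * cpow x a * (expR (- x))%:C.

Definition half_line : set R := `]0, +oo[.

Definition leb : {measure set (measurableTypeR R) -> \bar R} :=
  @lebesgue_measure R.

Definition leb2 := (@lebesgue_measure R \x @lebesgue_measure R)%E.

Definition pairing_integrand w1 w2 f g (p : R * R) : R[i] :=
  w1 p.1 * w2 p.2 / (p.1 + p.2)%:C * f p.1 * g p.2.

Definition pairing w1 w2 f g : R[i] :=
  cintegral leb2 (half_line `*` half_line) (pairing_integrand w1 w2 f g).

Definition pairing_finite w1 w2 f g : Prop :=
  cintegrable leb2 (half_line `*` half_line) (pairing_integrand w1 w2 f g).

Definition monomial k x : R[i] := x%:C ^+ k.

Definition peval (p : {poly R[i]}) x : R[i] := p.[x%:C].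

Definition moment w1 w2 j k : R[i] := pairing w1 w2 (monomial j) (monomial k).

Definition bimoment_det w1 w2 n : R[i] :=
  \det (\matrix_(j < n, k < n) moment w1 w2 j k).

Definition weight_integral w (p : {poly R[i]}) : R[i] :=
  cintegral leb half_line (fun x => w x * peval p x).

(* The function p^(1)(z), for z off the half-line. *)
Definition cauchy_transform w (p : {poly R[i]}) z : R[i] :=
  cintegral leb half_line (fun x => w x / (z - x%:C) * peval p x).

Definition biorthogonal_polynomials w1 w2
    (S : nat -> R[i]) (P Q : nat -> {poly R[i]}) : Prop :=
  [/\ forall n, S n ^+ 2 = bimoment_det w1 w2 n / bimoment_det w1 w2 n.+1,
      forall n, size (P n) = n.+1 /\ lead_coef (P n) = S n,
      forall n, size (Q n) = n.+1 /\ lead_coef (Q n) = S n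
    & forall m n, pairing w1 w2 (peval (P m)) (peval (Q n)) = (m == n)%:R].

End biorthogonal.

Section constraints.
Variable K : fieldType.

(* The quantities occurring in the constraints. [cA] and [cB] stand for the
   factors xi s^(a+1) e^(-s) and psi t^(b+1) e^(-t); [cPs n], [cQ1s n],
   [cP1t n], [cQt n] stand for P_n(s), Q_n^(1)(-s), P_n^(1)(-t), Q_n(t). *)
Record constraint_data := ConstraintData {
  ca : K; cb : K; cs : K; ct : K; cA : K; cB : K;
  cS : nat -> K; cX : nat -> K; cY : nat -> K;
  cpi : nat -> K; ceta : nat -> K;
  cPs : nat -> K; cQ1s : nat -> K; cP1t : nat -> K; cQt : nat -> K }.

(* f_(n-1), with f_(-1) = 0 *)
Definition prev_idx (f : nat -> K) (n : nat) : K :=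
  if n is m.+1 then f m else 0.

Variables (D : constraint_data) (n : nat).

Local Notation a := (ca D).
Local Notation b := (cb D).
Local Notation s := (cs D).
Local Notation t := (ct D).
Local Notation A := (cA D).
Local Notation B := (cB D).
Local Notation S := (cS D).
Local Notation X := (cX D).
Local Notation Y := (cY D).
Local Notation pi_ := (cpi D).
Local Notation eta_ := (ceta D).
Local Notation Ps := (cPs D).
Local Notation Q1s := (cQ1s D).
Local Notation P1t := (cP1t D).
Local Notation Qt := (cQt D).
Local Notation rnext := (S n / S n.+1).
Local Notation rprev := (prev_idx S n / S n).

(* In the next four definitions [pin], [pip], [etan], [etap] are put in the
   places of pi_(n+1), pi_(n-1), eta_(n+1), eta_(n-1): their actual values in
   the constraints, unknowns in the linear system. *)
Definition rhs_ii (pin etap : K) : K :=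
  rnext * pin * eta_ n - rprev * pi_ n * etap
  - A * (rnext * Ps n.+1 * Q1s n - rprev * Ps n * prev_idx Q1s n)
  - B * (rnext * P1t n.+1 * Qt n - rprev * P1t n * prev_idx Qt n).

Definition rhs_iii (pip etan : K) : K :=
  rnext * pi_ n * etan - rprev * pip * eta_ n
  - A * (rnext * Ps n * Q1s n.+1 - rprev * prev_idx Ps n * Q1s n)
  - B * (rnext * P1t n * Qt n.+1 - rprev * prev_idx P1t n * Qt n).

Definition lhs_iv (etan etap : K) : K :=
  X n - n%:R - a
  - (S n * etan) / (S n.+1 * eta_ n)
  + (prev_idx S n * etap) / (S n * eta_ n)
  + A / (pi_ n * eta_ n) * Q1s n *
      (rnext * Ps n.+1 - (Y n + s) * Ps n - rprev * prev_idx Ps n)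
  + B / (pi_ n * eta_ n) * Qt n *
      (rnext * P1t n.+1 - (Y n - t) * P1t n - rprev * prev_idx P1t n).

Definition lhs_v (pin pip : K) : K :=
  Y n - n%:R - b
  - (S n * pin) / (S n.+1 * pi_ n)
  + (prev_idx S n * pip) / (S n * pi_ n)
  + A / (pi_ n * eta_ n) * Ps n *
      (rnext * Q1s n.+1 - (X n - s) * Q1s n - rprev * prev_idx Q1s n)
  + B / (pi_ n * eta_ n) * P1t n *
      (rnext * Qt n.+1 - (X n + t) * Qt n - rprev * prev_idx Qt n).

Definition constraint_i : Prop :=
  X n + Y n = pi_ n * eta_ n /\
  pi_ n * eta_ n =
    (2 * n)%:R + a + b + 1 + A * Ps n * Q1s n + B * P1t n * Qt n.

Definition constraint_ii : Prop := X n = rhs_ii (pi_ n.+1) (prev_idx eta_ n).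

Definition constraint_iii : Prop := Y n = rhs_iii (prev_idx pi_ n) (eta_ n.+1).

Definition constraint_iv : Prop := lhs_iv (eta_ n.+1) (prev_idx eta_ n) = 0.

Definition constraint_v : Prop := lhs_v (pi_ n.+1) (prev_idx pi_ n) = 0.

(* The unknowns are u = (pi_(n+1), pi_(n-1), eta_(n+1), eta_(n-1)); relations
   (ii)-(v) say that the residual at u vanishes. *)
Definition system_residual (u : 'cV[K]_4) : 'cV[K]_4 :=
  let: (pin, pip, etan, etap) := (u 0 0, u 1 0, u 2 0, u 3 0) in
  \col_(i < 4) [:: X n - rhs_ii pin etap; Y n - rhs_iii pip etan;
                   lhs_iv etan etap; lhs_v pin pip]`_i.

(* [M] and [c] are uniquely determined by the residual. *)
Definition is_linear_system (M : 'M[K]_4) (c : 'cV[K]_4) : Prop :=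
  forall u : 'cV[K]_4, system_residual u = M *m u - c.

End constraints.

Definition biorthogonal_data (R : realType) (a b xi psi : R[i]) (s t : R)
    (S : nat -> R[i]) (P Q : nat -> {poly R[i]}) : constraint_data R[i] :=
  let w1 := weight xi s a in
  let w2 := weight psi t b in
  {| ca := a; cb := b; cs := s%:C; ct := t%:C;
     cA := xi * cpow s (a + 1) * (expR (- s))%:C;
     cB := psi * cpow t (b + 1) * (expR (- t))%:C;
     cS := S;
     cX := fun n => pairing w1 w2 (peval ('X * P n)) (peval (Q n));
     cY := fun n => pairing w1 w2 (peval (P n)) (peval ('X * Q n));
     cpi := fun n => weight_integral w1 (P n);
     ceta := fun n => weight_integral w2 (Q n);
     cPs := fun n => peval (P n) s;
     cQ1s := fun n => cauchy_transform w2 (Q n) (- s%:C);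
     cP1t := fun n => cauchy_transform w1 (P n) (- t%:C);
     cQt := fun n => peval (Q n) t |}.

(* Main.v *)
Require Import Defs.
From mathcomp Require Import all_boot all_order all_algebra.
From mathcomp Require Import complex.
From mathcomp Require Import all_classical all_reals all_analysis.
From mathcomp Require Import unstable measurable_realfun.
From mathcomp Require Import ring lra.

Set Implicit Arguments.
Unset Strict Implicit.
Unset Printing Implicit Defensive.

Import Order.TTheory GRing.Theory Num.Theory.
Import numFieldNormedType.Exports.
Local Open Scope classical_set_scope.
Local Open Scope ring_scope.
Local Open Scope complex_scope.

(* Write <f,g> for the pairing, I1 f, I2 g for the integrals of w1 f, w2 g, and
   A, B for the factors xi s^(a+1) e^(-s), psi t^(b+1) e^(-t). On polynomials,
     <xf,g> + <f,yg> = I1(f) I2(g),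
     <xf',g> + <f,yg'> + (a+b+1) <f,g> - I1(f) I2(g)
       + A f(s) g^(1)(-s) + B f^(1)(-t) g(t) = 0,
     I1(xf') + (a+1) I1(f) - I1(xf) = A f(s), and likewise for I2.
   The last two are integrations by parts on the half-line: the jumps of the
   weights at s and t give the terms in A and B, and since
   x/(x+y) + y/(x+y) = 1, the derivatives of 1/(x+y) contribute -<f,g>.
   Constraint (i) is the second identity at (P_n, Q_n). Comparing sub-leading
   coefficients, X_{n,n} is r <xP_{n+1}',Q_n> - q <xP_n',Q_{n-1}> with
   r = S_n/S_{n+1} and q = S_{n-1}/S_n, which gives (ii). For (iv), let
   K = sum_{k<=n} eta_k P_k, so that <K,g> = I2(g) when deg g <= n; then
   x P_n = r P_{n+1} - Y_{n,n} P_n - q P_{n-1} + pi_n K turns the brackets of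
   (iv) into values of K and K^(1), and the second identity at (K, Q_n)
   evaluates these. Exchanging the two weights gives (iii) and (v). *)

(** Reduces an equation to a known one: what remains, for [ring] or [field], is that one difference
    of sides is a multiple of the other. *)
Lemma eq_from_combination (K : pzRingType) (x y u v c : K) :
  u = v -> x - y = c * (u - v) -> x = y.
Proof. by move=> ->; rewrite subrr mulr0 => /eqP; rewrite subr_eq0 => /eqP. Qed.

(** * Biorthogonal polynomials for an abstract pairing *)

Section scalar_forms.
Context {K : fieldType} {U : lmodType K} (l : U -> K) (l_lin : scalar l).

Lemma scalar_formD u v : l (u + v) = l u + l v.
Proof. by rewrite -[u in LHS]scale1r l_lin mul1r. Qed.

Lemma scalar_form0 : l 0 = 0.
Proof. by apply: (@addIr _ (l 0)); rewrite -scalar_formD !add0r. Qed.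

Lemma scalar_formZ c u : l (c *: u) = c * l u.
Proof. by rewrite -[c *: u]addr0 l_lin scalar_form0 addr0. Qed.

Lemma scalar_formN u : l (- u) = - l u.
Proof. by rewrite -scaleN1r scalar_formZ mulN1r. Qed.

Lemma scalar_formB u v : l (u - v) = l u - l v.
Proof. by rewrite scalar_formD scalar_formN. Qed.

Lemma scalar_form_sum n (F : 'I_n -> U) : l (\sum_(i < n) F i) = \sum_(i < n) l (F i).
Proof.
by elim/big_ind2: _ => [|u1 u2 v1 v2 <- <-|//]; [exact: scalar_form0|exact: scalar_formD].
Qed.

End scalar_forms.

Lemma scalar_poly_eq (K : fieldType) (l1 l2 : {poly K} -> K) :
  scalar l1 -> scalar l2 -> (forall k, l1 'X^k = l2 'X^k) -> l1 =1 l2.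
Proof.
move=> h1 h2 e p; rewrite -[p]coefK poly_def (scalar_form_sum h1) (scalar_form_sum h2).
by apply: eq_bigr => i _; rewrite (scalar_formZ h1) (scalar_formZ h2) e.
Qed.

Section biorthogonal_expansion.
Variables (K : fieldType) (B : {poly K} -> {poly K} -> K).
Variables (S : nat -> K) (P Q : nat -> {poly K}).
Hypotheses (B_lin : forall g, scalar (B^~ g)) (S_neq0 : forall n, S n != 0).
Hypotheses (sizeP : forall n, size (P n) = n.+1).
Hypotheses (leadP : forall n, lead_coef (P n) = S n).
Hypotheses (BPQ : forall m n, B (P m) (Q n) = (m == n)%:R).

Lemma coef_lead n : (P n)`_n = S n.
Proof. by rewrite -leadP lead_coefE sizeP. Qed.

(** Since the top coefficient of [P n] is the nonzero [S n], this multiple of [P n] removes the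
    degree [n] term exactly. *)
Lemma size_cancel_lead (f : {poly K}) n : (size f <= n.+1)%N ->
  (size (f - (f`_n / S n) *: P n)%R <= n)%N.
Proof.
move=> sf; apply/leq_sizeP => j; rewrite leq_eqVlt => /predU1P[<-|nj].
  by rewrite coefB coefZ coef_lead divfK ?S_neq0// subrr.
rewrite coefB coefZ (@nth_default _ _ f j) ?(leq_trans sf)//.
by rewrite (@nth_default _ _ (P n)) ?sizeP// mulr0 subrr.
Qed.

(** Induction on [n]: stripping the top multiple of [P n] leaves a combination of lower [P k], which
    pairs to 0 with [Q n]. Hence the stripped coefficient is [B f (Q n)], and the lower coefficients
    are unaffected. *)
Lemma biorthogonal_expansion n (f : {poly K}) : (size f <= n)%N ->
  f = \sum_(k < n) B f (Q k) *: P k.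
Proof.
elim: n f => [|n ih] f sf.
  by rewrite big_ord0; apply/eqP; rewrite -size_poly_eq0 -leqn0.
have := ih _ (size_cancel_lead sf); set c := _ / _ => e.
have BfQ k : B f (Q k) = B (f - c *: P n) (Q k) + c * (n == k)%:R.
  by rewrite (scalar_formB (B_lin _)) (scalar_formZ (B_lin _)) BPQ subrK.
rewrite big_ord_recr /= BfQ eqxx mulr1.
have -> : B (f - c *: P n) (Q n) = 0.
  rewrite e (scalar_form_sum (B_lin _)) big1// => i _.
  by rewrite (scalar_formZ (B_lin _)) BPQ ltn_eqF ?mulr0.
rewrite add0r -[LHS](subrK (c *: P n)) {1}e; congr (_ + _).
apply: eq_bigr => i _; rewrite BfQ.
by rewrite eq_sym ltn_eqF// mulr0 addr0.
Qed.

Lemma orthogonal_low (f : {poly K}) n : (size f <= n)%N -> B f (Q n) = 0.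
Proof.
move=> sf; rewrite (biorthogonal_expansion sf) (scalar_form_sum (B_lin _)) big1// => i _.
by rewrite (scalar_formZ (B_lin _)) BPQ ltn_eqF ?mulr0.
Qed.

Lemma pairing_lead (f : {poly K}) n : (size f <= n.+1)%N -> B f (Q n) = f`_n / S n.
Proof.
move=> sf; have := orthogonal_low (size_cancel_lead sf).
rewrite (scalar_formB (B_lin _)) (scalar_formZ (B_lin _)) BPQ eqxx mulr1.
by move/eqP; rewrite subr_eq0 => /eqP.
Qed.

(** Removing the [P n.+1] component, which [Q n] does not see, leaves degree at most [n], where only
    the top coefficient counts. *)
Lemma pairing_sublead (f : {poly K}) n : (size f <= n.+2)%N ->
  B f (Q n) = (f`_n - f`_n.+1 / S n.+1 * (P n.+1)`_n) / S n.
Proof.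
move=> sf; have := pairing_lead (size_cancel_lead sf).
rewrite (scalar_formB (B_lin _)) (scalar_formZ (B_lin _)) BPQ gtn_eqF// mulr0 subr0.
by rewrite coefB coefZ.
Qed.

Lemma sizeXP n : size ('X * P n) = n.+2.
Proof. by rewrite mulrC size_mulX ?sizeP// -size_poly_gt0 sizeP. Qed.

Lemma coefXderiv (f : {poly K}) n : ('X * f^`())`_n = f`_n *+ n.
Proof. by rewrite coefXM; case: n => [|n]; rewrite ?mulr0n//= coef_deriv. Qed.

Lemma size_Xderiv (f : {poly K}) n : (size f <= n)%N -> (size ('X * f^`())%R <= n)%N.
Proof.
move=> sf; apply/leq_sizeP => j nj; rewrite coefXderiv nth_default ?mul0rn//.
exact: leq_trans nj.
Qed.

(** Both sides reduce to subleading coefficients of [P n.+1] and [P n]. At [n = 0] the term with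
    [Q n.-1] is killed by [prev_idx S 0 = 0]. *)
Lemma pairing_XP_diag n : B ('X * P n) (Q n) =
  S n / S n.+1 * B ('X * (P n.+1)^`()) (Q n)
  - prev_idx S n / S n * B ('X * (P n)^`()) (Q n.-1).
Proof.
have S0 k : S k != 0 by [].
(* With c the coefficient of degree [m] in [P m.+1], the operator x d/dx contributes m c and
   cancelling the top term subtracts (m + 1) c, leaving - c. *)
have D m : B ('X * (P m.+1)^`()) (Q m) = - (P m.+1)`_m / S m.
  rewrite pairing_sublead ?size_Xderiv ?sizeP// !coefXderiv coef_lead.
  by rewrite mulrS -(mulr_natr (S _)) -(mulr_natr _`_m); field; rewrite !S0.
rewrite D pairing_sublead ?sizeXP// !coefXM /= coef_lead.
case: n => [|n] /=; first by field; rewrite !S0.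
by rewrite D; field; rewrite !S0.
Qed.

Lemma pairing_XP_up n : B ('X * P n) (Q n.+1) = S n / S n.+1.
Proof. by rewrite pairing_lead ?sizeXP// coefXM /= coef_lead. Qed.

Lemma pairing_Xderiv_diag n : B ('X * (P n)^`()) (Q n) = n%:R.
Proof.
rewrite pairing_lead ?size_Xderiv ?sizeP// coefXderiv coef_lead -(mulr_natl (S n)) mulfK//.
Qed.

End biorthogonal_expansion.

Section kernel_expansion.
Variables (K : fieldType) (B : {poly K} -> {poly K} -> K) (L1 L2 : {poly K} -> K).
Variables (S : nat -> K) (P Q : nat -> {poly K}).
Hypotheses (B_linl : forall g, scalar (B^~ g)) (B_linr : forall f, scalar (B f)).
Hypotheses (S_neq0 : forall n, S n != 0).
Hypotheses (sizeP : forall n, size (P n) = n.+1) (sizeQ : forall n, size (Q n) = n.+1).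
Hypotheses (leadP : forall n, lead_coef (P n) = S n).
Hypotheses (leadQ : forall n, lead_coef (Q n) = S n).
Hypotheses (BPQ : forall m n, B (P m) (Q n) = (m == n)%:R).
Hypotheses (BX : forall f g, B ('X * f) g + B f ('X * g) = L1 f * L2 g).

(** Transposing the pairing makes the results on its left argument available for the right one. *)
Let BQP m n : B^~ (Q m) (P n) = (m == n)%:R.
Proof. by rewrite /= BPQ eq_sym. Qed.

Let ortho_r (g : {poly K}) n : (size g <= n)%N -> B (P n) g = 0 :=
  @orthogonal_low _ (fun g f => B f g) S Q P B_linr S_neq0 sizeQ leadQ BQP g n.

(** Expand ['X * P n] in the [P k]. For [k <= n], [BX] turns each coefficient into
    [L1 (P n) * L2 (Q k)] minus [B (P n) ('X * Q k)], and by orthogonality the latter survives only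
    for [k] equal to n and n - 1. *)
Lemma mulXP_kernel n : 'X * P n =
  (S n / S n.+1) *: P n.+1 - B (P n) ('X * Q n) *: P n
  - (prev_idx S n / S n) *: P n.-1 + L1 (P n) *: \sum_(k < n.+1) L2 (Q k) *: P k.
Proof.
have -> : 'X * P n = \sum_(k < n.+2) B ('X * P n) (Q k) *: P k.
  by apply: (biorthogonal_expansion B_linl S_neq0 sizeP leadP BPQ);
     rewrite (sizeXP sizeP).
rewrite big_ord_recr /= (pairing_XP_up B_linl S_neq0 sizeP leadP BPQ) addrC -!addrA.
congr (_ + _).
under eq_bigr => i _ do rewrite -[B _ _](addrK (B (P n) ('X * Q i))) BX scalerBl -scalerA.
rewrite sumrB -scaler_sumr [LHS]addrC [RHS]addrA; congr (_ + _).
rewrite big_ord_recr /= opprD addrC; congr (_ + _); congr (- _).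
case: n => [|n] /=; first by rewrite big_ord0 mul0r scale0r.
rewrite big_ord_recr /= big1 ?add0r => [|i _].
  have -> // : B (P n.+1) ('X * Q n) = S n / S n.+1.
  exact: (@pairing_XP_up _ (fun g f => B f g) S Q P B_linr S_neq0 sizeQ leadQ BQP).
by rewrite ortho_r ?scale0r// (sizeXP sizeQ) ltnS.
Qed.

End kernel_expansion.

(** * Constraints (i), (ii) and (iv) from the identities for the functionals *)

Section constraints_of_functionals.
Variables (K : fieldType) (B : {poly K} -> {poly K} -> K).
Variables (L1 L2 C1 C2 : {poly K} -> K) (a b s t A1 A2 : K).
Variables (S : nat -> K) (P Q : nat -> {poly K}).
Hypotheses (B_linl : forall g, scalar (B^~ g)) (B_linr : forall f, scalar (B f)).
Hypotheses (L1_lin : scalar L1) (L2_lin : scalar L2).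
Hypotheses (C1_lin : scalar C1).
Hypotheses (S_neq0 : forall n, S n != 0).
Hypotheses (sizeP : forall n, size (P n) = n.+1) (sizeQ : forall n, size (Q n) = n.+1).
Hypotheses (leadP : forall n, lead_coef (P n) = S n).
Hypotheses (leadQ : forall n, lead_coef (Q n) = S n).
Hypotheses (BPQ : forall m n, B (P m) (Q n) = (m == n)%:R).
Hypotheses (L1_neq0 : forall n, L1 (P n) != 0) (L2_neq0 : forall n, L2 (Q n) != 0).
Hypotheses (BX : forall f g, B ('X * f) g + B f ('X * g) = L1 f * L2 g).
Hypotheses (Bderiv : forall f g,
  B ('X * f^`()) g + B f ('X * g^`()) + (a + b + 1) * B f g - L1 f * L2 g
  + A1 * f.[s] * C2 g + A2 * C1 f * g.[t] = 0).
Hypotheses (L2deriv : forall g,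
  L2 ('X * g^`()) + (b + 1) * L2 g - L2 ('X * g) = A2 * g.[t]).
Hypotheses (C1X : forall f, - t * C1 f = L1 f + C1 ('X * f)).

Definition functional_data := {| ca := a; cb := b; cs := s; ct := t;
  cA := A1; cB := A2; cS := S;
  cX := fun n => B ('X * P n) (Q n); cY := fun n => B (P n) ('X * Q n);
  cpi := fun n => L1 (P n); ceta := fun n => L2 (Q n);
  cPs := fun n => (P n).[s]; cQ1s := fun n => C2 (Q n);
  cP1t := fun n => C1 (P n); cQt := fun n => (Q n).[t] |}.

Let BQP m n : B^~ (Q m) (P n) = (m == n)%:R.
Proof. by rewrite /= BPQ eq_sym. Qed.

Let ortho_r (g : {poly K}) n : (size g <= n)%N -> B (P n) g = 0 :=
  @orthogonal_low _ (fun g f => B f g) S Q P B_linr S_neq0 sizeQ leadQ BQP g n.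

(** The operator x d/dx multiplies the top coefficient by [n], so each of the two derivative terms
    contributes [n]. *)
Lemma functional_constraint_i n : constraint_i functional_data n.
Proof.
split=> /=; first exact: BX.
have := Bderiv (P n) (Q n).
rewrite (pairing_Xderiv_diag B_linl S_neq0 sizeP leadP BPQ).
have -> : B (P n) ('X * (Q n)^`()) = n%:R.
  exact: (@pairing_Xderiv_diag _ (fun g f => B f g) S Q P B_linr S_neq0 sizeQ leadQ BQP).
rewrite BPQ eqxx mulr1 mul2n -addnn natrD => e.
by apply/eqP; rewrite -subr_eq0; apply/eqP; rewrite -[LHS]opprK -[RHS]oppr0 -e; ring.
Qed.

Lemma functional_constraint_ii n : constraint_ii functional_data n.
Proof.
rewrite /constraint_ii /rhs_ii /= (pairing_XP_diag B_linl S_neq0 sizeP leadP BPQ).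
(* For [k < m], [P m] is orthogonal to both y Q_k' and Q_k, so the derivative identity leaves x P_m'
   against Q_k as its only unknown term. *)
have D m k : (k < m)%N -> B ('X * (P m)^`()) (Q k) =
    L1 (P m) * L2 (Q k) - A1 * (P m).[s] * C2 (Q k) - A2 * C1 (P m) * (Q k).[t].
  move=> km; have := Bderiv (P m) (Q k).
  rewrite ortho_r ?size_Xderiv ?sizeQ// BPQ gtn_eqF// mulr0 !addr0 => e.
  by apply/eqP; rewrite -subr_eq0 -[X in _ == X]e; apply/eqP; ring.
by rewrite D//; case: n => [|n] /=; rewrite ?(D n.+1 n)//; ring.
Qed.

(** The Christoffel-Darboux kernel, the sum of P_k(x) Q_k(y) over k <= n, with [L2] applied in the
    variable y. *)
Let kernel_poly n := \sum_(k < n.+1) L2 (Q k) *: P k.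

Lemma size_kernel n : (size (kernel_poly n) <= n.+1)%N.
Proof.
apply: (leq_trans (size_sum _ _ _)); apply/bigmax_leqP => i _.
by rewrite (leq_trans (size_scale_leq _ _))// sizeP.
Qed.

Lemma kernel_reproducing n (g : {poly K}) : (size g <= n.+1)%N -> B (kernel_poly n) g = L2 g.
Proof.
move=> sg.
rewrite (@biorthogonal_expansion _ (fun g f => B f g) S Q P B_linr S_neq0 sizeQ leadQ BQP _ _ sg).
rewrite (scalar_form_sum (B_linr _)) (scalar_form_sum L2_lin); apply: eq_bigr => i _.
rewrite (scalar_formZ (B_linr _)) (scalar_formZ L2_lin) /kernel_poly (scalar_form_sum (B_linl _)).
rewrite (bigD1 i)//= (scalar_formZ (B_linl _)) BPQ eqxx mulr1 big1 ?addr0// => j ji.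
by rewrite (scalar_formZ (B_linl _)) BPQ (_ : (_ == _) = false) ?mulr0//; apply: negbTE.
Qed.

Lemma functional_constraint_iv n : constraint_iv functional_data n.
Proof.
rewrite /constraint_iv /lhs_iv /=.
have BQX f g : B f ('X * g) + B ('X * f) g = L2 g * L1 f by rewrite addrC BX mulrC.
have xP := mulXP_kernel B_linl B_linr S_neq0 sizeP sizeQ leadP leadQ BPQ BX n.
have xQ := mulXP_kernel B_linr B_linl S_neq0 sizeQ sizeP leadQ leadP BQP
  (fun g f => BQX f g) n.
rewrite -/(kernel_poly n) in xP.
have D := Bderiv (kernel_poly n) (Q n).
rewrite !kernel_reproducing ?size_Xderiv ?sizeQ// in D.
(* The coefficient of x^n in the kernel polynomial is [S n * L2 (Q n)], as its pairing with [Q n]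
   shows; x d/dx multiplies it by [n]. *)
have DK : B ('X * (kernel_poly n)^`()) (Q n) = n%:R * L2 (Q n).
  rewrite (pairing_lead B_linl S_neq0 sizeP leadP BPQ) ?size_Xderiv ?size_kernel//.
  rewrite coefXderiv -[_ *+ n]mulr_natl -mulrA; congr (_ * _).
  rewrite -(pairing_lead B_linl S_neq0 sizeP leadP BPQ) ?size_kernel//.
  by apply: kernel_reproducing; rewrite sizeQ.
rewrite {}DK in D; have E := L2deriv (Q n).
(* Applying [L2] to the recurrence for y Q_n brings in the values of [L2] at [Q n.+1] and [Q n.-1],
   together with [L1] of the kernel polynomial. *)
move/(congr1 L2): xQ E; rewrite !(scalar_formD L2_lin) !(scalar_formN L2_lin) !(scalar_formZ L2_lin).
have sumL : L2 (\sum_(k < n.+1) L1 (P k) *: Q k) = L1 (kernel_poly n).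
  rewrite (scalar_form_sum L2_lin) (scalar_form_sum L1_lin); apply: eq_bigr => i _.
  by rewrite (scalar_formZ L1_lin) (scalar_formZ L2_lin) mulrC.
rewrite sumL => -> E.
(* [C1X] and the recurrence for x P_n evaluate the bracket of transforms; the summand [L1 (P n)] in
   [C1X] is the source of the 1 in [1 + k_1] below. *)
have C := C1X (P n).
move: (congr1 C1 xP) C; rewrite !(scalar_formD C1_lin) !(scalar_formN C1_lin) !(scalar_formZ C1_lin) => -> C.
have H := congr1 (horner^~ s) xP.
rewrite /= hornerM hornerX !hornerE in H.
set k_s := (kernel_poly n).[s] in D H; set k_1 := C1 (kernel_poly n) in D C.
have p0 := L1_neq0 n; have e0 := L2_neq0 n.
(* At [n = 0] the index [n.-1] is 0 rather than -1; the factor [prev_idx S 0 = 0] reconciles the two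
   conventions. *)
have prevE (l : {poly K} -> K) (R : nat -> {poly K}) :
    prev_idx S n / S n * prev_idx (fun m => l (R m)) n = prev_idx S n / S n * l (R n.-1).
  by case: n {H C E D k_s k_1 xP sumL p0 e0} => [|m] //=; rewrite mul0r !mul0r.
have prevE_div : prev_idx S n / S n * (prev_idx (fun m => L2 (Q m)) n / L2 (Q n))
    = prev_idx S n / S n * L2 (Q n.-1) / L2 (Q n) by rewrite mulrA prevE.
rewrite (prevE (horner^~ s)) (prevE C1) -!mulf_div prevE_div.
have -> : S n / S n.+1 * (P n.+1).[s] - (B (P n) ('X * Q n) + s) * (P n).[s] -
    prev_idx S n / S n * (P n.-1).[s] = - (L1 (P n) * k_s).
  by apply: (eq_from_combination (c := -1) H); ring.
have -> : S n / S n.+1 * C1 (P n.+1) - (B (P n) ('X * Q n) - t) * C1 (P n) -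
    prev_idx S n / S n * C1 (P n.-1) = - (L1 (P n) * (1 + k_1)).
  by apply: (eq_from_combination (c := -1) C); ring.
(* Subtracting [E] from [D] cancels both [L2] of y Q_n' and [L1] of the kernel polynomial; division
   by [- L2 (Q n)] then gives (iv). *)
apply: (eq_from_combination (c := - (L2 (Q n))^-1) (congr2 (fun x y => x - y) D E)).
by set r := S n / _; set q := _ / S n; field; rewrite p0 e0.
Qed.

End constraints_of_functionals.

(** * Exchange of the two weights *)

Definition swap_data (K : fieldType) (D : constraint_data K) : constraint_data K :=
  {| ca := cb D; cb := ca D; cs := ct D; ct := cs D; cA := cB D; cB := cA D;
     cS := cS D; cX := cY D; cY := cX D; cpi := ceta D; ceta := cpi D;
     cPs := cQt D; cQ1s := cP1t D; cP1t := cQ1s D; cQt := cPs D |}.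

Lemma constraint_iii_swap (K : fieldType) (D : constraint_data K) n :
  constraint_ii (swap_data D) n -> constraint_iii D n.
Proof.
by rewrite /constraint_ii /constraint_iii /rhs_ii /rhs_iii /= => ->; ring.
Qed.

Lemma constraint_v_swap (K : fieldType) (D : constraint_data K) n :
  constraint_iv (swap_data D) n -> constraint_v D n.
Proof.
rewrite /constraint_iv /constraint_v /lhs_iv /lhs_v /= => <-.
by rewrite [cpi D n * _]mulrC; ring.
Qed.

Section functional_constraints.
Variables (K : fieldType) (B : {poly K} -> {poly K} -> K).
Variables (L1 L2 C1 C2 : {poly K} -> K) (a b s t A1 A2 : K).
Variables (S : nat -> K) (P Q : nat -> {poly K}).
Hypotheses (B_linl : forall g, scalar (B^~ g)) (B_linr : forall f, scalar (B f)).
Hypotheses (L1_lin : scalar L1) (L2_lin : scalar L2).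
Hypotheses (C1_lin : scalar C1) (C2_lin : scalar C2).
Hypotheses (S_neq0 : forall n, S n != 0).
Hypotheses (sizeP : forall n, size (P n) = n.+1) (sizeQ : forall n, size (Q n) = n.+1).
Hypotheses (leadP : forall n, lead_coef (P n) = S n).
Hypotheses (leadQ : forall n, lead_coef (Q n) = S n).
Hypotheses (BPQ : forall m n, B (P m) (Q n) = (m == n)%:R).
Hypotheses (L1_neq0 : forall n, L1 (P n) != 0) (L2_neq0 : forall n, L2 (Q n) != 0).
Hypotheses (BX : forall f g, B ('X * f) g + B f ('X * g) = L1 f * L2 g).
Hypotheses (Bderiv : forall f g,
  B ('X * f^`()) g + B f ('X * g^`()) + (a + b + 1) * B f g - L1 f * L2 g
  + A1 * f.[s] * C2 g + A2 * C1 f * g.[t] = 0).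
Hypotheses (L1deriv : forall f,
  L1 ('X * f^`()) + (a + 1) * L1 f - L1 ('X * f) = A1 * f.[s]).
Hypotheses (L2deriv : forall g,
  L2 ('X * g^`()) + (b + 1) * L2 g - L2 ('X * g) = A2 * g.[t]).
Hypotheses (C1X : forall f, - t * C1 f = L1 f + C1 ('X * f)).
Hypotheses (C2X : forall g, - s * C2 g = L2 g + C2 ('X * g)).

Let BQP m n : B (P n) (Q m) = (m == n)%:R.
Proof. by rewrite BPQ eq_sym. Qed.

Let BX' g f : B f ('X * g) + B ('X * f) g = L2 g * L1 f.
Proof. by rewrite addrC BX mulrC. Qed.

Let Bderiv' g f :
  B f ('X * g^`()) + B ('X * f^`()) g + (b + a + 1) * B f g - L2 g * L1 f
  + A2 * g.[t] * C1 f + A1 * C2 g * f.[s] = 0.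
Proof. by rewrite -[RHS](Bderiv f g); ring. Qed.

Lemma functional_constraints n :
  let D := functional_data B L1 L2 C1 C2 a b s t A1 A2 S P Q in
  [/\ constraint_i D n, constraint_ii D n, constraint_iii D n,
      constraint_iv D n & constraint_v D n].
Proof.
split.
- exact: functional_constraint_i.
- exact: functional_constraint_ii.
- apply: constraint_iii_swap.
  exact: (@functional_constraint_ii _ (fun g f => B f g) L2 L1 C2 C1 b a t s A2 A1 S Q P).
- exact: functional_constraint_iv.
- apply: constraint_v_swap.
  exact: (@functional_constraint_iv _ (fun g f => B f g) L2 L1 C2 C1 b a t s A2 A1 S Q P).
Qed.

End functional_constraints.

(** * Dependency and rank of the system (ii)-(v) *)

Section linear_system.
Variables (K : fieldType) (D : constraint_data K) (n : nat).
Hypotheses (pi_neq0 : cpi D n != 0) (eta_neq0 : ceta D n != 0).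

Let p := cpi D n.
Let e := ceta D n.
Let r := cS D n / cS D n.+1.
Let q := prev_idx (cS D) n / cS D n.

(** Multiplied by [p * e], the four unknowns enter (iv) + (v) exactly as they enter (ii) + (iii), so
    the difference is free of them. When the residuals vanish and X + Y = p e, what is left is p e
    times the second equation of (i). *)
Lemma residual_dependency pin pip etan etap :
  p * e * (lhs_iv D n etan etap + lhs_v D n pin pip) =
  (cX D n - rhs_ii D n pin etap) + (cY D n - rhs_iii D n pip etan)
  + (p * e - 1) * (cX D n + cY D n)
  - p * e * ((2 * n)%:R + ca D + cb D)
  - (cX D n + cY D n) * (cA D * cPs D n * cQ1s D n + cB D * cP1t D n * cQt D n).
Proof.
rewrite /lhs_iv /lhs_v /rhs_ii /rhs_iii -!mulf_div mul2n -addnn natrD -/p -/e -/r -/q.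
by field; rewrite pi_neq0 eta_neq0.
Qed.

Lemma constraint_i_of_ii_v : cX D n + cY D n = p * e ->
  constraint_ii D n -> constraint_iii D n -> constraint_iv D n ->
  constraint_v D n -> constraint_i D n.
Proof.
move=> XY ii iii iv v; split => //.
have := residual_dependency (cpi D n.+1) (prev_idx (cpi D) n)
  (ceta D n.+1) (prev_idx (ceta D) n).
rewrite [lhs_iv _ _ _ _]iv [lhs_v _ _ _ _]v -ii -iii !subrr XY => E.
apply: (mulfI (mulf_neq0 pi_neq0 eta_neq0)); apply/eqP; rewrite -subr_eq0.
move/eqP: E; rewrite -subr_eq0 => /eqP E; apply/eqP; rewrite -[RHS]oppr0 -E.
by rewrite -/p -/e; ring.
Qed.

Definition system_mx : 'M[K]_4 := \matrix_(i < 4, j < 4)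
  (nth [::] [:: [:: - (r * e); 0; 0; q * p]; [:: 0; q * e; - (r * p); 0];
      [:: 0; 0; - (r / e); q / e]; [:: - (r / p); q / p; 0; 0]] i)`_j.

(** The residual is affine in the unknowns, so its value at 0 is its constant part. *)
Definition system_rhs : 'cV[K]_4 := - system_residual D n 0.

Lemma system_mxP : is_linear_system D n system_mx system_rhs.
Proof.
move=> u; apply/matrixP => i j; rewrite !ord1 {j} !mxE.
rewrite !big_ord_recl big_ord0 !mxE /=.
rewrite /lhs_iv /lhs_v /rhs_ii /rhs_iii -!mulf_div -/p -/e -/r -/q.
have -> : lift ord0 ord0 = 1 :> 'I_4 by apply: val_inj.
have -> : lift ord0 (lift ord0 ord0) = 2 :> 'I_4 by apply: val_inj.
have -> : lift ord0 (lift ord0 (lift ord0 ord0)) = 3 :> 'I_4 by apply: val_inj.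
by case: i => [[|[|[|[|i]]]] hi] //=; ring.
Qed.

Lemma system_mx_rows : exists v : 'rV[K]_4, v != 0 /\ v *m system_mx = 0.
Proof.
(* Up to sign, the coefficients with which (ii)-(v) enter [residual_dependency]. *)
exists (\row_(i < 4) [:: 1; 1; - (p * e); - (p * e)]`_i).
split.
  by apply/eqP => /matrixP/(_ 0 0); rewrite !mxE /= => /eqP; rewrite oner_eq0.
apply/matrixP => i j; rewrite !mxE !big_ord_recl big_ord0 !mxE /=.
by case: j => [[|[|[|[|j]]]] hj] //=; field; rewrite ?pi_neq0 ?eta_neq0.
Qed.

Lemma rank_system_mx_le : (\rank system_mx <= 3)%N.
Proof.
have [v [v0 vM]] := system_mx_rows; rewrite leqNgt; apply: contra v0 => rk.
have : row_free system_mx by rewrite /row_free eqn_leq rank_leq_row.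
by move=> free; rewrite -(mulmx_free_eq0 v free) vM.
Qed.

(** The first three rows, cut to the first three columns, form a triangular matrix with diagonal - r
    e, q e, - r / e. *)
Lemma rank_system_mx_ge : r != 0 -> q != 0 -> (3 <= \rank system_mx)%N.
Proof.
move=> r0 q0.
pose f (i : 'I_3) : 'I_4 := widen_ord (isT : 3 <= 4)%N i.
have : row_free (rowsub f system_mx).
  apply/inj_row_free => v.
  move=> /matrixP vM; apply/matrixP => i j; rewrite !ord1 {i}.
  have v0 := vM 0 0; have v1 := vM 0 1; have v2 := vM 0 2.
  move: v0 v1 v2; rewrite !mxE !big_ord_recl !big_ord0 !mxE /=.
  have re0 : - (r * e) != 0 by rewrite oppr_eq0 mulf_neq0.
  have qe0 : q * e != 0 by rewrite mulf_neq0.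
  have rVe0 : - (r / e) != 0 by rewrite oppr_eq0 mulf_neq0 ?invr_neq0.
  rewrite !mulr0 !addr0 !add0r => /eqP; rewrite mulf_eq0 (negbTE re0) orbF => /eqP v0.
  move=> /eqP; rewrite mulf_eq0 (negbTE qe0) orbF => /eqP v1.
  rewrite v1 mul0r add0r => /eqP; rewrite mulf_eq0 (negbTE rVe0) orbF => /eqP v2.
  case: j => [[|[|[|j]]] hj] //.
  - by rewrite -[RHS]v0; congr (v 0 _); apply: val_inj.
  - by rewrite -[RHS]v1; congr (v 0 _); apply: val_inj.
  - by rewrite -[RHS]v2; congr (v 0 _); apply: val_inj.
by move=> /eqP rk; rewrite -[leqLHS]rk rowsubE mxrankM_maxr.
Qed.

(** A solution [u] puts the right-hand side in the column span: the augmented matrix is the system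
    matrix times the row of blocks 1 and [u]. *)
Lemma rank_augmented (u : 'cV[K]_4) : system_residual D n u = 0 ->
  \rank (row_mx system_mx system_rhs) = \rank system_mx.
Proof.
rewrite system_mxP => /eqP; rewrite subr_eq0 => /eqP <-.
apply/eqP; rewrite eqn_leq; apply/andP; split.
  by rewrite -[X in row_mx X _]mulmx1 -mul_mx_row mxrankM_maxl.
have {1}-> : system_mx = row_mx system_mx (system_mx *m u) *m col_mx 1%:M 0.
  by rewrite mul_row_col mulmx1 mulmx0 addr0.
exact: mxrankM_maxl.
Qed.

End linear_system.

(** * Complex-valued integrals *)

Section complex_parts.
Context {R : realType}.
Implicit Types z w : R[i].

Lemma complex_ReD z w : complex.Re (z + w) = complex.Re z + complex.Re w.
Proof. by case: z w => [? ?] []. Qed.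

Lemma complex_ImD z w : complex.Im (z + w) = complex.Im z + complex.Im w.
Proof. by case: z w => [? ?] []. Qed.

Lemma complex_ReM z w :
  complex.Re (z * w) = complex.Re z * complex.Re w - complex.Im z * complex.Im w.
Proof. by case: z w => [? ?] []. Qed.

Lemma complex_ImM z w :
  complex.Im (z * w) = complex.Re z * complex.Im w + complex.Im z * complex.Re w.
Proof. by case: z w => [? ?] []. Qed.

Lemma complex_eqP z w :
  complex.Re z = complex.Re w -> complex.Im z = complex.Im w -> z = w.
Proof. by case: z w => [? ?] [? ?] /= -> ->. Qed.

(** Equivalent to the modulus but with values in [R], so that it can be compared with real
    dominating functions. *)
Definition norm1 z := `|complex.Re z| + `|complex.Im z|.

Lemma norm1_ge0 z : 0 <= norm1 z. Proof. by rewrite addr_ge0. Qed.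

Lemma le_Re_norm1 z : `|complex.Re z| <= norm1 z.
Proof. by rewrite lerDl. Qed.

Lemma le_Im_norm1 z : `|complex.Im z| <= norm1 z.
Proof. by rewrite lerDr. Qed.

Lemma norm1_real (x : R) : norm1 x%:C = `|x|.
Proof. by rewrite /norm1 /= normr0 addr0. Qed.

Lemma norm1N z : norm1 (- z) = norm1 z.
Proof. by case: z => x y; rewrite /norm1 /= !normrN. Qed.

Lemma norm1D z w : norm1 (z + w) <= norm1 z + norm1 w.
Proof.
rewrite /norm1 complex_ReD complex_ImD addrACA.
by apply: lerD; exact: ler_normD.
Qed.

Lemma norm1M z w : norm1 (z * w) <= norm1 z * norm1 w.
Proof.
rewrite /norm1 complex_ReM complex_ImM.
apply: (le_trans (lerD (ler_normB _ _) (ler_normD _ _))); rewrite !normrM.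
by rewrite le_eqVlt; apply/orP; left; apply/eqP; ring.
Qed.

End complex_parts.

Section complex_integral_theory.
Context d (T : measurableType d) (R : realType).
Variables (mu : {measure set T -> \bar R}) (D : set T) (mD : measurable D).
Implicit Types f g : T -> R[i].

Definition cmeasurable f := measurable_fun D (complex.Re (R := R) \o f) /\
  measurable_fun D (complex.Im (R := R) \o f).

Lemma cintegrable_measurable f : cintegrable mu D f -> cmeasurable f.
Proof.
by move=> [/measurable_int/measurable_EFinP ? /measurable_int/measurable_EFinP].
Qed.

Lemma cmeasurable_real (f : T -> R) :
  measurable_fun D f -> cmeasurable (fun x => (f x)%:C).
Proof. by move=> mf; split => //; exact: measurable_cst. Qed.

Lemma cmeasurable_cst z : cmeasurable (fun=> z).
Proof. by split; exact: measurable_cst. Qed.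

Lemma eq_cmeasurable f g : (forall x, D x -> f x = g x) ->
  cmeasurable f -> cmeasurable g.
Proof.
move=> fg [f1 f2]; split; [apply: eq_measurable_fun f1|apply: eq_measurable_fun f2];
  by move=> x; rewrite inE => Dx /=; rewrite fg.
Qed.

Lemma cmeasurableM f g : cmeasurable f -> cmeasurable g ->
  cmeasurable (fun x => f x * g x).
Proof.
move=> [f1 f2] [g1 g2]; split.
- rewrite [X in measurable_fun _ X](_ : _ = fun x => complex.Re (f x) * complex.Re (g x)
    - complex.Im (f x) * complex.Im (g x)); last first.
    by apply/funext => x; rewrite /= complex_ReM.
  by apply: measurable_funB; exact: measurable_funM.
- rewrite [X in measurable_fun _ X](_ : _ = fun x => complex.Re (f x) * complex.Im (g x)
    + complex.Im (f x) * complex.Re (g x)); last first.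
    by apply/funext => x; rewrite /= complex_ImM.
  by apply: measurable_funD; exact: measurable_funM.
Qed.

Lemma cmeasurableD f g : cmeasurable f -> cmeasurable g ->
  cmeasurable (fun x => f x + g x).
Proof.
move=> [f1 f2] [g1 g2]; split.
- rewrite [X in measurable_fun _ X](_ : _ = fun x => complex.Re (f x) + complex.Re (g x)).
    exact: measurable_funD.
  by apply/funext => x; rewrite /= complex_ReD.
- rewrite [X in measurable_fun _ X](_ : _ = fun x => complex.Im (f x) + complex.Im (g x)).
    exact: measurable_funD.
  by apply/funext => x; rewrite /= complex_ImD.
Qed.

Lemma cintegrable_le f (g : T -> R) : cmeasurable f ->
  mu.-integrable D (EFin \o g) -> (forall x, D x -> norm1 (f x) <= g x) ->
  cintegrable mu D f.
Proof.
move=> [f1 f2] ig fg; split; apply: le_integrable ig => //;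
  try (by apply/measurable_EFinP); move=> x Dx;
  rewrite /= lee_fin (le_trans _ (ler_norm _))// (le_trans _ (fg x Dx))//.
- exact: le_Re_norm1.
- exact: le_Im_norm1.
Qed.

Lemma integrable_norm1 f : cintegrable mu D f ->
  mu.-integrable D (EFin \o (fun x => norm1 (f x))).
Proof.
move=> [f1 f2].
have := integrableD mD (integrable_norm f1) (integrable_norm f2).
by apply: eq_integrable.
Qed.

Lemma cintegrable_dominated f g k : cmeasurable f -> cintegrable mu D g ->
  (forall x, D x -> norm1 (f x) <= k * norm1 (g x)) -> cintegrable mu D f.
Proof.
move=> mf ig; apply: cintegrable_le => //.
have := integrableZl mD k (integrable_norm1 ig).
by apply: eq_integrable.
Qed.

Lemma eq_cintegrable f g : (forall x, D x -> f x = g x) ->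
  cintegrable mu D f -> cintegrable mu D g.
Proof.
move=> fg [f1 f2]; split; [apply: eq_integrable f1|apply: eq_integrable f2] => //;
  by move=> x; rewrite inE => Dx /=; rewrite fg.
Qed.

Lemma eq_cintegral f g : (forall x, D x -> f x = g x) ->
  cintegral mu D f = cintegral mu D g.
Proof.
move=> fg; congr (_ +i* _); apply: eq_Rintegral => x; rewrite inE => Dx /=;
  by rewrite fg.
Qed.

Lemma cintegrableD f g : cintegrable mu D f -> cintegrable mu D g ->
  cintegrable mu D (fun x => f x + g x).
Proof.
move=> [f1 f2] [g1 g2]; split.
- by have := integrableD mD f1 g1; apply: eq_integrable => // x _; rewrite /= complex_ReD.
- by have := integrableD mD f2 g2; apply: eq_integrable => // x _; rewrite /= complex_ImD.
Qed.

Lemma cintegralD f g : cintegrable mu D f -> cintegrable mu D g ->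
  cintegral mu D (fun x => f x + g x) = cintegral mu D f + cintegral mu D g.
Proof.
move=> [f1 f2] [g1 g2]; apply: complex_eqP; rewrite ?complex_ReD ?complex_ImD /=.
- rewrite -RintegralD//; apply: eq_Rintegral => x _; exact: complex_ReD.
- rewrite -RintegralD//; apply: eq_Rintegral => x _; exact: complex_ImD.
Qed.

Lemma cintegrableZ c f : cintegrable mu D f -> cintegrable mu D (fun x => c * f x).
Proof.
move=> fi; apply: (@cintegrable_dominated _ f (norm1 c)) => //.
  apply: cmeasurableM; [exact: cmeasurable_cst|exact: cintegrable_measurable].
by move=> x _; exact: norm1M.
Qed.

Lemma cintegralZ c f : cintegrable mu D f ->
  cintegral mu D (fun x => c * f x) = c * cintegral mu D f.
Proof.
move=> [f1 f2].
have ZR r (g : T -> R) : mu.-integrable D (EFin \o g) ->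
    mu.-integrable D (EFin \o (fun x => r * g x)).
  by move=> ig; have := integrableZl mD r ig; exact: eq_integrable.
apply: complex_eqP; rewrite ?complex_ReM ?complex_ImM /=.
- rewrite -!RintegralZl// -RintegralB//; try exact: ZR.
  by apply: eq_Rintegral => x _; exact: complex_ReM.
- rewrite -!RintegralZl// -RintegralD//; try exact: ZR.
  by apply: eq_Rintegral => x _; exact: complex_ImM.
Qed.

Lemma cintegrable_lin c f g : cintegrable mu D f -> cintegrable mu D g ->
  cintegrable mu D (fun x => c * f x + g x).
Proof. by move=> fi gi; apply: cintegrableD => //; exact: cintegrableZ. Qed.

Lemma cintegral_lin c f g : cintegrable mu D f -> cintegrable mu D g ->
  cintegral mu D (fun x => c * f x + g x) = c * cintegral mu D f + cintegral mu D g.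
Proof.
by move=> fi gi; rewrite cintegralD ?cintegralZ//; exact: cintegrableZ.
Qed.

End complex_integral_theory.

(** * Fubini and the exchange of variables on the quadrant *)

Section half_line_fubini.
Context {R : realType}.
Local Notation H := (@half_line R).
Local Notation leb := (@leb R).
Local Notation leb2 := (@leb2 R).

Lemma measurable_half_line : measurable (H : set (measurableTypeR R)).
Proof. exact: measurable_itv. Qed.

Lemma measurable_quadrant :
  measurable (H `*` H : set (measurableTypeR R * measurableTypeR R)).
Proof. by apply: measurableX; exact: measurable_itv. Qed.

(** Fubini is applied to the extension by zero to the plane, whose sections are the extensions by
    zero of the sections. *)
Let restrE1 (f : R * R -> R) x y : ((EFin \o f) \_ (H `*` H)) (x, y) =
  if x \in H then ((fun y => (f (x, y))%:E) \_ H) y else 0%E.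
Proof.
rewrite patchE in_setX /=; case: ifPn => [/andP[-> yH]|].
  by rewrite patchE yH.
by rewrite negb_and patchE; case: (x \in H) => //= /negbTE ->.
Qed.

Let restrE2 (f : R * R -> R) x y : ((EFin \o f) \_ (H `*` H)) (x, y) =
  if y \in H then ((fun x => (f (x, y))%:E) \_ H) x else 0%E.
Proof.
rewrite patchE in_setX /=; case: ifPn => [/andP[xH ->]|].
  by rewrite patchE xH.
by rewrite negb_and patchE; case: (y \in H) => //=; rewrite ?orbF => /negbTE ->.
Qed.

(** An inner integral is finite only almost everywhere; replacing it by its finite part changes
    nothing under the outer integral. *)
Let integral_fine (F : R -> \bar R) : leb.-integrable setT F ->
  (\int[leb]_x F x = \int[leb]_x (fine (F x))%:E)%E.
Proof.
move=> iF; have mF := measurable_int _ iF.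
apply: ae_eq_integral => //.
  by apply/measurable_EFinP; exact: measurableT_comp.
have := integrable_ae measurableT iF; apply: filterS => x /= /(_ I) fF _.
by rewrite fineK.
Qed.

(** By Tonelli, integrability is finiteness of the iterated integral of the absolute value in either
    order, and [swap] exchanges the two orders. *)
Let integrable_swapT (f : R * R -> \bar R) :
  leb2.-integrable setT f -> leb2.-integrable setT (f \o swap).
Proof.
move=> fi; have mf := measurable_int _ fi.
have mfs := measurableT_comp mf (@measurable_swap _ _ (measurableTypeR R) (measurableTypeR R)).
pose m : {sigma_finite_measure set (measurableTypeR R) -> \bar R} := @lebesgue_measure R.
have h := (@integrable21ltyP _ _ _ _ R m m f mf).1 fi.
have k := @integrable12ltyP _ _ _ _ R m m (f \o swap) mfs.
exact: k.2.
Qed.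

Lemma integrable_swap (f : R * R -> R) :
  leb2.-integrable (H `*` H) (EFin \o f) ->
  leb2.-integrable (H `*` H) (EFin \o f \o swap).
Proof.
move=> /(integrable_mkcond _ measurable_quadrant) fi.
apply/(integrable_mkcond _ measurable_quadrant).
have -> : (EFin \o f \o swap) \_ (H `*` H) = ((EFin \o f) \_ (H `*` H)) \o swap.
  by apply/funext => -[x y]; rewrite /= !patchE !in_setX /= andbC.
exact: integrable_swapT.
Qed.

Lemma Rintegral_fubini12 (f : R * R -> R) :
  leb2.-integrable (H `*` H) (EFin \o f) ->
  \int[leb2]_(p in H `*` H) f p =
  \int[leb]_(x in H) \int[leb]_(y in H) f (x, y).
Proof.
move=> /(integrable_mkcond _ measurable_quadrant) fi.
rewrite /Rintegral integral_mkcond -(integral12_prod_meas1 fi); congr fine.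
rewrite [RHS]integral_mkcond (integral_fine (integrable_fubini_F fi)).
apply: eq_integral => x _; rewrite patchE /fubini_F.
under eq_integral do rewrite restrE1.
case: ifPn => xH; last by rewrite integral0.
by rewrite -integral_mkcond.
Qed.

Lemma Rintegral_fubini21 (f : R * R -> R) :
  leb2.-integrable (H `*` H) (EFin \o f) ->
  \int[leb2]_(p in H `*` H) f p =
  \int[leb]_(y in H) \int[leb]_(x in H) f (x, y).
Proof.
move=> /(integrable_mkcond _ measurable_quadrant) fi.
rewrite /Rintegral integral_mkcond -(integral21_prod_meas1 fi); congr fine.
rewrite [RHS]integral_mkcond (integral_fine (integrable_fubini_F (integrable_swapT fi))).
apply: eq_integral => y _; rewrite patchE /fubini_F /=.
under eq_integral do rewrite restrE2.
case: ifPn => yH; last by rewrite integral0.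
by rewrite -integral_mkcond.
Qed.

Lemma Rintegral_swap (f : R * R -> R) :
  leb2.-integrable (H `*` H) (EFin \o f) ->
  \int[leb2]_(p in H `*` H) f (swap p) = \int[leb2]_(p in H `*` H) f p.
Proof.
by move=> fi; rewrite (Rintegral_fubini21 fi) Rintegral_fubini12//; exact: integrable_swap.
Qed.

Lemma cintegral_fubini12 (f : R * R -> R[i]) : cintegrable leb2 (H `*` H) f ->
  cintegral leb2 (H `*` H) f =
  cintegral leb H (fun x => cintegral leb H (fun y => f (x, y))).
Proof. by move=> [f1 f2]; rewrite /cintegral !Rintegral_fubini12. Qed.

Lemma cintegral_fubini21 (f : R * R -> R[i]) : cintegrable leb2 (H `*` H) f ->
  cintegral leb2 (H `*` H) f =
  cintegral leb H (fun y => cintegral leb H (fun x => f (x, y))).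
Proof. by move=> [f1 f2]; rewrite /cintegral !Rintegral_fubini21. Qed.

Lemma cintegrable_swap (f : R * R -> R[i]) : cintegrable leb2 (H `*` H) f ->
  cintegrable leb2 (H `*` H) (f \o swap).
Proof. by move=> [/integrable_swap f1 /integrable_swap f2]. Qed.

Lemma cintegral_swap (f : R * R -> R[i]) : cintegrable leb2 (H `*` H) f ->
  cintegral leb2 (H `*` H) (f \o swap) = cintegral leb2 (H `*` H) f.
Proof.
by move=> [f1 f2]; rewrite /cintegral -(Rintegral_swap f1) -(Rintegral_swap f2).
Qed.

End half_line_fubini.

(** * Integration by parts on the half-line *)

Section primitive_on_ray.
Context {R : realType}.
Variables (c : R) (f F : R -> R).
Hypothesis dF : forall x, c < x -> is_derive x 1 F (f x).
Hypothesis cf : forall x, c < x -> {for x, continuous f}.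
Local Notation mu := (@lebesgue_measure R).

(** Compact intervals exhausting the ray and avoiding [c], where nothing is assumed of [F]. The
    shift to [n.+2] keeps the endpoints apart at [n = 0]. *)
Let seg n : set R := `[c + n.+1%:R^-1, c + n.+2%:R].

Let seg_gt n x : seg n x -> c < x.
Proof.
rewrite /seg/= in_itv/= => /andP[+ _]; apply: lt_le_trans.
by rewrite ltrDl invr_gt0.
Qed.

Let integral_seg n :
  (\int[mu]_(x in seg n) (f x)%:E = (F (c + n.+2%:R))%:E - (F (c + n.+1%:R^-1))%:E)%E.
Proof.
have ab : c + n.+1%:R^-1 < c + n.+2%:R :> R.
  by rewrite ltrD2l (@le_lt_trans _ _ 1) ?ltr1n// invf_le1 ?ler1n.
have cF x : c < x -> {for x, continuous F}.
  by move=> cx; apply: differentiable_continuous; apply/derivable1_diffP; have [] := dF cx.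
apply: continuous_FTC2 => //.
- apply: continuous_in_subspaceT => x; rewrite inE => xs.
  exact: cf (seg_gt xs).
- split.
  + move=> x xab; have cx : c < x by apply: (@seg_gt n); apply: subset_itv_oo_cc xab.
    by have [] := dF cx.
  + by apply: cvg_at_right_filter; apply: cF; rewrite ltrDl invr_gt0.
  + by apply: cvg_at_left_filter; apply: cF; rewrite ltrDl.
- move=> x xab; have cx : c < x by apply: (@seg_gt n); apply: subset_itv_oo_cc xab.
  by rewrite derive1E; have [] := dF cx.
Qed.

Let measurable_seg n : measurable (seg n : set (measurableTypeR R)).
Proof. exact: measurable_itv. Qed.

Let mf : measurable_fun (`]c, +oo[ : set (measurableTypeR R)) f.
Proof.
apply: open_continuous_measurable_fun => //.
by move=> x; rewrite inE/= in_itv/= andbT => cx; exact: cf.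
Qed.

Let seg_sub n : seg n `<=` `]c, +oo[.
Proof. by move=> x /seg_gt; rewrite /= in_itv/= andbT. Qed.

Let near_seg x : c < x -> \forall n \near \oo, seg n x.
Proof.
move=> cx; near=> n; rewrite /seg/= in_itv/=; apply/andP; split.
- rewrite -lerBrDl ltW//; near: n.
  have xc : 0 < x - c by rewrite subr_gt0.
  exact: (near_infty_natSinv_lt (PosNum xc)).
- rewrite -lerBlDl (@le_trans _ _ n%:R)//; last by rewrite ler_nat -addn2 leq_addr.
  by near: n; exact: nbhs_infty_ger.
Unshelve. all: by end_near. Qed.

(** Monotone convergence along [seg]: each partial integral is a difference of two values of [F] in
    [0, M], hence at most [M]. *)
Lemma primitive_ge0_integrable M : (forall x, c < x -> 0 <= f x) ->
  (forall x, c < x -> 0 <= F x <= M) -> mu.-integrable `]c, +oo[ (EFin \o f).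
Proof.
move=> f0 FM; apply/integrableP; split; first exact/measurable_EFinP.
have -> : `]c, +oo[%classic = \bigcup_n seg n.
  apply/seteqP; split => [x|x [n _]]; last exact: seg_sub.
  rewrite /= in_itv/= andbT => /near_seg [N _ /(_ N (leqnn _))] ?.
  by exists N.
have ndseg : nondecreasing_seq seg.
  apply/nondecreasing_seqP => n; rewrite subsetEset => x.
  rewrite /seg/= !in_itv/= => /andP[h1 h2]; apply/andP; split.
    by apply: le_trans h1; rewrite lerD2l lef_pV2 ?posrE// ler_nat.
  by apply: (le_trans h2); rewrite lerD2l ler_nat.
have mfs n : measurable_fun (seg n : set (measurableTypeR R)) (EFin \o f).
  apply/measurable_EFinP; apply: measurable_funS mf; [exact: measurable_itv|exact: seg_sub].
have h := ge0_nondecreasing_set_cvg_integral (mu := @Defs.leb R) ndseg measurable_seg mfs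
  (fun n x sx => f0 x (seg_gt sx)).
rewrite (@le_lt_trans _ _ M%:E) ?ltry//.
have <- : (\int[mu]_(x in \bigcup_i seg i) (EFin \o f) x =
    \int[mu]_(x in \bigcup_n seg n) `|(EFin \o f) x|)%E.
  apply: eq_integral => x; rewrite inE => -[n _ /seg_gt cx].
  by rewrite /= ger0_norm// f0.
apply: (cvge_le _ h); apply: nearW => n.
rewrite integral_seg -EFinB lee_fin.
have /andP[_] : 0 <= F (c + n.+2%:R) <= M by apply: FM; rewrite ltrDl.
have /andP[] : 0 <= F (c + n.+1%:R^-1) <= M by apply: FM; rewrite ltrDl invr_gt0.
by move=> *; lra.
Qed.

(** Dominated convergence along [seg], with |f| as the bound, takes the fundamental theorem of
    calculus to the limit. *)
Lemma primitive_integral l0 l1 : mu.-integrable `]c, +oo[ (EFin \o f) ->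
  F (c + n.+1%:R^-1) @[n --> \oo] --> l0 -> F (c + n.+2%:R) @[n --> \oo] --> l1 ->
  \int[mu]_(x in `]c, +oo[) f x = l1 - l0.
Proof.
move=> fi F0 F1.
have [] := @dominated_convergence _ _ _ mu `]c, +oo[ (measurable_itv _)
  (fun n => (EFin \o f) \_ (seg n)) (EFin \o f) (abse \o (EFin \o f)).
- move=> n; apply/measurable_restrict => //.
  by apply/measurable_EFinP; apply: measurable_funS mf => //; exact: subIsetl.
- exact/measurable_EFinP.
- apply: aeW => x; rewrite /= in_itv/= andbT => /near_seg sx.
  apply: cvg_near_cst; apply: filterS sx => n sx.
  by rewrite patchE mem_set.
- exact: integrable_abse.
- apply: aeW => x n _; rewrite patchE; case: ifPn => // _.
  by rewrite /= normr0 lee_fin.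
move=> _ _ h.
have k : (\int[mu]_(x in `]c, +oo[) ((EFin \o f) \_ (seg n)) x)%E @[n --> \oo]
    --> (l1 - l0)%:E.
  have -> : (fun n => \int[mu]_(x in `]c, +oo[) ((EFin \o f) \_ (seg n)) x)%E =
      (fun n => (F (c + n.+2%:R) - F (c + n.+1%:R^-1))%:E).
    apply/funext => n; rewrite -integral_mkcondr setIidr; first exact: integral_seg.
    exact: seg_sub.
  by apply: cvg_EFin; [exact: nearW|exact: cvgB].
by rewrite /Rintegral (cvg_unique _ h k).
Qed.

End primitive_on_ray.

(** * Powers times exponentials on the half-line: derivatives, bounds, limits *)

Section ray_functions.
Context {R : realType}.
Implicit Types (p x y b : R) (m : nat).
Local Notation H := (@half_line R).
Local Notation leb := (@leb R).

Lemma is_derive_ln_shift y x : 0 < x + y -> is_derive x 1 (fun z => ln (z + y)) (x + y)^-1.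
Proof.
move=> xy0.
have := @is_derive1_comp _ (@ln R) (fun z => z + y) x _ 1 (is_derive1_ln xy0).
by rewrite mulr1; apply; apply: is_derive_eq; rewrite addr0.
Qed.

(** For positive x and y, [ray_fun p m y x] is x^p e^(-x) / (x + y)^m. *)
Definition ray_exponent p m y x := p * ln x - x - m%:R * ln (x + y).
Definition ray_fun p m y x := expR (ray_exponent p m y x).

Lemma is_derive_ray_exponent p m y x : 0 < y -> 0 < x ->
  is_derive x 1 (ray_exponent p m y) (p / x - 1 - m%:R / (x + y)).
Proof.
move=> y0 x0; have xy0 : 0 < x + y by rewrite addr_gt0.
have h1 := is_derive1_ln x0.
have h2 := is_derive_ln_shift xy0.
apply: (@is_derive_eq _ _ _ _ _ _ (p *: x^-1 - 1 - m%:R *: (x + y)^-1)) => //.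
Qed.

Lemma is_derive_ray_wave (u u' : R -> R) b p m y x : 0 < y -> 0 < x ->
  (forall z : R, is_derive z 1 u (u' z)) ->
  is_derive x 1 (fun z => u (b * ln z) * ray_fun p m y z)
   (ray_fun p m y x / x * (u (b * ln x) * (p - x - m%:R * x / (x + y))
      + u' (b * ln x) * b)).
Proof.
move=> y0 x0 du; have xy0 : 0 < x + y by rewrite addr_gt0.
have h1 := is_derive1_ln x0.
have h2 := is_derive_ray_exponent p m y0 x0.
have h3 : is_derive x 1 (ray_fun p m y)
    (ray_fun p m y x * (p / x - 1 - m%:R / (x + y))).
  exact: (@is_derive1_comp _ expR (ray_exponent p m y) x).
have h4 : is_derive x 1 (fun z => b * ln z) (b * x^-1).
  exact: is_derive_eq.
have h5 : is_derive x 1 (fun z => u (b * ln z)) (u' (b * ln x) * (b * x^-1)).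
  exact: (@is_derive1_comp _ u (fun z => b * ln z) x).
have h6 := is_deriveM h5 h3.
have e : u (b * ln x) *: (ray_fun p m y x * (p / x - 1 - m%:R / (x + y)))
    + ray_fun p m y x *: (u' (b * ln x) * (b * x^-1)) =
    ray_fun p m y x / x * (u (b * ln x) * (p - x - m%:R * x / (x + y))
      + u' (b * ln x) * b).
  by rewrite /GRing.scale /=; field; rewrite !gt_eqF.
exact: is_derive_eq h6 e.
Qed.

(* With z = x / (x + 1), this is z^p, whose derivative p x^(p-1) / (x+1)^(p+1)
   dominates x^(p-1) e^(-x) times any polynomial and is integrable because z^p
   is bounded. *)
Definition ray_bound p x := expR (p * (ln x - ln (x + 1))).

Lemma ray_bound_le1 p x : 0 <= p -> 0 < x -> ray_bound p x <= 1.
Proof.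
move=> p0 x0; rewrite -expR0 ler_expR -(mulr0 p) ler_wpM2l// subr_le0.
by rewrite ler_ln ?posrE ?addr_gt0// lerDl.
Qed.

Lemma is_derive_ray_bound p x : 0 < x ->
  is_derive x 1 (ray_bound p) (p * ray_bound p x / (x * (x + 1))).
Proof.
move=> x0; have x1 : 0 < x + 1 by rewrite addr_gt0.
have h1 := is_derive1_ln x0.
have h2 := is_derive_ln_shift x1.
have h3 : is_derive x 1 (fun z => p * (ln z - ln (z + 1))) (p * (x^-1 - (x + 1)^-1)).
  by apply: is_derive_eq; rewrite /GRing.scale /=; ring.
have h4 : is_derive x 1 (ray_bound p) (ray_bound p x * (p * (x^-1 - (x + 1)^-1))).
  exact: (@is_derive1_comp _ expR (fun z => p * (ln z - ln (z + 1))) x).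
have -> // : p * ray_bound p x / (x * (x + 1)) =
  ray_bound p x * (p * (x^-1 - (x + 1)^-1)).
by field; rewrite !gt_eqF.
Qed.

(** The quotient of [ray_fun] by [ray_bound] is (x+1)^p e^(-x) / (x+y)^m. Here (x+y)^(-m) <= y^(-m),
    and a power (x+1)^(N+2) with N > p is at most (N+2)! e^(x+1) by the exponential series. *)
Lemma ray_fun_bound p m y : 0 < y ->
  exists C, forall x, 0 < x -> ray_fun p m y x <= C * (ray_bound p x / (x + 1) ^+ 2).
Proof.
move=> y0; pose N := (Num.truncn p).+1.
exists (expR (1 - m%:R * ln y) * (N.+2)`!%:R) => x x0.
have x1 : 0 < x + 1 by rewrite addr_gt0.
rewrite mulrA ler_pdivlMr ?exprn_gt0//.
have -> : ray_fun p m y x = ray_bound p x *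
    (expR (p * ln (x + 1)) * expR (- x - m%:R * ln (x + y))).
  rewrite /ray_fun /ray_bound -!expRD /ray_exponent; congr expR; ring.
rewrite [leRHS]mulrC -mulrA ler_pM2l ?expR_gt0//.
rewrite mulrAC -ler_pdivlMr ?expR_gt0// -expRN.
apply: (@le_trans _ _ ((x + 1) ^+ N.+2)).
  rewrite -(addn2 N) exprD ler_pM2r ?exprn_gt0//.
  rewrite -{2}(lnK x1) -expRM_natl ler_expR ler_wpM2r//; last first.
    by rewrite ltW// truncnS_gt.
  by rewrite ln_ge0// lerDr ltW.
rewrite -ler_pdivrMl ?mulr_gt0 ?expR_gt0 ?ltr0n ?fact_gt0//.
rewrite invfM -mulrA [_ * (x + 1) ^+ _]mulrC -expRN.
apply: (@le_trans _ _ (expR (- (1 - m%:R * ln y)) * expR (x + 1))).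
  rewrite ler_pM2l ?expR_gt0// (le_trans _ (expR_ge1Dxn N.+1 (ltW x1)))//.
  by rewrite lerDr.
rewrite -expRD ler_expR.
have : m%:R * ln y <= m%:R * ln (x + y).
  by rewrite ler_wpM2l// ler_ln ?posrE ?addr_gt0// lerDr ltW.
lra.
Qed.

Lemma measurable_ray_exponent p m y : measurable_fun [set: R] (ray_exponent p m y).
Proof.
apply: measurable_funB; first apply: measurable_funB => //.
  by apply: measurable_funM => //; exact: measurable_ln.
apply: measurable_funM => //; apply: (measurableT_comp (@measurable_ln R)).
exact: measurable_funD.
Qed.

Lemma continuous_ray_bound_deriv p x : 0 < x ->
  {for x, continuous (fun z => p * ray_bound p z / (z * (z + 1)))}.
Proof.
move=> x0; have x1 : 0 < x + 1 by rewrite addr_gt0.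
have h := is_derive_ray_bound p x0.
have c : {for x, continuous (ray_bound p)}.
  by apply: differentiable_continuous; apply/derivable1_diffP; have [] := h.
apply: cvgM; first by apply: cvgM => //; exact: cvg_cst.
apply: cvgV; first by rewrite mulf_neq0 ?gt_eqF.
apply: cvgM; first exact: cvg_id.
by apply: cvgD; [exact: cvg_id|exact: cvg_cst].
Qed.

Lemma half_lineP x : H x <-> 0 < x.
Proof. by rewrite /half_line /= in_itv/= andbT. Qed.

Lemma measurable_inv_half_line y : 0 <= y ->
  measurable_fun H (fun x : R => (x + y)^-1).
Proof.
move=> y0; apply: open_continuous_measurable_fun; first exact: interval_open.
move=> x; rewrite inE => /half_lineP x0.
apply: cvgV; first by rewrite gt_eqF// ltr_pwDl.
by apply: cvgD; [exact: cvg_id|exact: cvg_cst].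
Qed.

(** The factor 1 / x lowers the exponent to that of the weight, p - 1 in place of p, and x + 1
    leaves room for one linearly growing factor. The derivative of [ray_bound] dominates the
    product. *)
Lemma integrable_ray_fun p m y : 0 < p -> 0 < y ->
  leb.-integrable H (EFin \o (fun x => ray_fun p m y x * ((x + 1) / x))).
Proof.
move=> p0 y0; have [C hC] := ray_fun_bound p m y0.
have ib : leb.-integrable H
    (EFin \o (fun x => p * ray_bound p x / (x * (x + 1)))).
  apply: (@primitive_ge0_integrable _ 0 _ (ray_bound p) _ _ 1).
  - by move=> x x0; exact: is_derive_ray_bound.
  - by move=> x x0; exact: continuous_ray_bound_deriv.
  - by move=> x x0; rewrite divr_ge0 ?mulr_ge0 ?expR_ge0 ?ltW// addr_gt0.
  - by move=> x x0; rewrite expR_ge0 ray_bound_le1// ltW.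
have := integrableZl measurable_half_line (C / p) ib.
apply: le_integrable; first exact: measurable_half_line.
  apply/measurable_EFinP; apply: measurable_funM.
    apply: measurable_funTS.
    exact: (measurableT_comp (@measurable_expR R) (measurable_ray_exponent p m y)).
  apply: measurable_funM; first by apply: measurable_funD.
  by apply: eq_measurable_fun (measurable_inv_half_line (lexx 0)) => x _; rewrite addr0.
move=> x /half_lineP x0; have x1 : 0 < x + 1 by rewrite addr_gt0.
rewrite /= lee_fin (le_trans _ (ler_norm _))// ger0_norm; last first.
  by rewrite mulr_ge0 ?expR_ge0// divr_ge0 ?ltW.
have -> : C / p * (p * ray_bound p x / (x * (x + 1))) =
    C * (ray_bound p x / (x + 1) ^+ 2) * ((x + 1) / x).
  by field; rewrite !gt_eqF.
by rewrite ler_pM2r ?divr_gt0// hC.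
Qed.

(** By [ray_fun_bound], the decay is at least that of x^p near 0 and of 1 / x at infinity. *)
Lemma ray_fun_cvg0 p m y c : 0 < p -> 0 < y -> 0 <= c ->
  ray_fun p m y (n.+1%:R^-1) @[n --> \oo] --> 0 /\
  ray_fun p m y (c + n.+2%:R) @[n --> \oo] --> 0.
Proof.
move=> p0 y0 c0; have [C hC] := ray_fun_bound p m y0.
have C0 : 0 <= C.
  have := hC 1 ltr01; rewrite -ler_pdivrMr ?divr_gt0 ?expR_gt0 ?exprn_gt0//.
  by apply: le_trans; rewrite divr_ge0 ?expR_ge0// divr_ge0 ?expR_ge0// exprn_ge0.
split.
- apply: (@squeeze_cvgr _ _ _ _ (cst 0) (fun n => C * (n.+1%:R^-1) `^ p)).
  + apply: nearW => n; rewrite expR_ge0/=.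
    have n0 : 0 < n.+1%:R^-1 :> R by rewrite invr_gt0.
    apply: (le_trans (hC _ n0)); rewrite ler_wpM2l//.
    rewrite ler_pdivrMr ?exprn_gt0 ?addr_gt0// (@le_trans _ _ (n.+1%:R^-1 `^ p))//.
      rewrite /ray_bound /powR gt_eqF// ler_expR ler_wpM2l ?(ltW p0)//.
      by rewrite lerBlDr lerDl ln_ge0// lerDr ltW.
    by rewrite ler_peMr ?powR_ge0// exprn_ege1// lerDr ltW.
  + exact: cvg_cst.
  + rewrite -[X in _ --> X](mulr0 C); apply: cvgM; first exact: cvg_cst.
    have /cvg_at_rightP h := powR_cvg0 p0.
    apply: (h (fun n => n.+1%:R^-1)); split => [n|]; first by rewrite invr_gt0.
    exact: cvg_harmonic.
- apply: (@squeeze_cvgr _ _ _ _ (cst 0) (fun n => C * n.+1%:R^-1)).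
  + apply: nearW => n; rewrite expR_ge0/=.
    have cn : 0 < c + n.+2%:R by rewrite ltr_wpDl.
    have cn1 : 1 <= c + n.+2%:R + 1 by rewrite lerDr ltW.
    apply: (le_trans (hC _ cn)); rewrite ler_wpM2l//.
    rewrite (@le_trans _ _ ((c + n.+2%:R + 1) ^+ 2)^-1)//.
      rewrite ler_piMl ?invr_ge0 ?exprn_ge0 ?(le_trans ler01)//.
      by rewrite ray_bound_le1// ltW.
    rewrite lef_pV2 ?posrE ?exprn_gt0 ?(lt_le_trans ltr01)//.
    rewrite (@le_trans _ _ (c + n.+2%:R + 1))//.
      by rewrite -addrA natr1 (@le_trans _ _ n.+3%:R) ?lerDr// ler_nat leqW.
    by rewrite expr2 ler_peMr// (le_trans ler01).
    by rewrite ler1n.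
  + exact: cvg_cst.
  + rewrite -[X in _ --> X](mulr0 C); apply: cvgM; first exact: cvg_cst.
    exact: cvg_harmonic.
Qed.

End ray_functions.

(** * The weights against monomials and Cauchy kernels *)

Section weighted_rays.
Context {R : realType}.
Implicit Types (a xi : R[i]) (x y s c : R) (j m : nat).
Local Notation H := (@half_line R).
Local Notation leb := (@leb R).

(** For [0 < x] this is x^(i b). *)
Definition phase b x : R[i] := cos (b * ln x) +i* sin (b * ln x).

Lemma norm1_phase b x : norm1 (phase b x) <= 2.
Proof.
by rewrite /norm1 /= lerD// ler_norml ?cos_geN1 ?cos_le1 ?sin_geN1 ?sin_le1.
Qed.

(** [m = 0] gives monomials; [m = 1] gives, up to sign, the integrand factor of the Cauchy transform
    at z = - y. *)
Definition cauchy_factor j m y x : R := x ^+ j / (x + y) ^+ m.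

Lemma cpowE a x : 0 < x ->
  cpow x a = (expR (complex.Re a * ln x))%:C * phase (complex.Im a) x.
Proof. by move=> x0; rewrite /cpow /powR gt_eqF. Qed.

Lemma ray_cpowE a j m y x : 0 < y -> 0 < x ->
  cpow x (a + 1) * (expR (- x))%:C * (cauchy_factor j m y x)%:C =
  (ray_fun (complex.Re a + 1 + j%:R) m y x)%:C * phase (complex.Im a) x.
Proof.
move=> y0 x0; have xy0 : 0 < x + y by rewrite addr_gt0.
rewrite cpowE// mulrAC -mulrA mulrAC -!rmorphM /=; congr (_%:C * _); last first.
  by rewrite complex_ImD addr0.
rewrite complex_ReD /cauchy_factor -{2}(lnK x0) -{1}(lnK xy0) -!expRM_natl -expRN.
by rewrite -!expRD; congr expR; rewrite /ray_exponent /=; ring.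
Qed.

Lemma cpowS a x : 0 < x -> cpow x (a + 1) = x%:C * cpow x a.
Proof.
move=> x0; rewrite !cpowE// complex_ReD complex_ImD addr0 mulrA -rmorphM /=.
by congr (_%:C * _); rewrite mulrDl mul1r expRD lnK// mulrC.
Qed.

Lemma gamma_rayE a j m y x : 0 < y -> 0 < x ->
  cpow x a * (expR (- x))%:C * (cauchy_factor j m y x)%:C =
  (ray_fun (complex.Re a + 1 + j%:R) m y x / x)%:C * phase (complex.Im a) x.
Proof.
move=> y0 x0; have xc : x%:C != 0 :> R[i] by rewrite (inj_eq (@complexI R)) gt_eqF.
apply: (mulfI xc).
transitivity (x%:C * cpow x a * (expR (- x))%:C * (cauchy_factor j m y x)%:C).
  by rewrite -!mulrA.
rewrite -cpowS// ray_cpowE// mulrA; congr (_ * _).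
by rewrite -rmorphM /= mulrC divfK ?gt_eqF.
Qed.

Lemma measurable_cauchy_factor j m y : 0 <= y -> measurable_fun H (cauchy_factor j m y).
Proof.
move=> y0; apply: measurable_funM; first exact: measurable_funX.
apply: (eq_measurable_fun (fun x => (x + y)^-1 ^+ m)).
  by move=> x _; rewrite exprVn.
by apply: measurable_funX; exact: measurable_inv_half_line.
Qed.

Lemma cmeasurable_weight xi s a : cmeasurable H (weight xi s a).
Proof.
apply: cmeasurableM; last first.
  apply: cmeasurable_real; apply: (measurableT_comp (@measurable_expR R)).
  exact: measurable_funTS.
apply: cmeasurableM.
  have -> : (fun x => 1 - xi * (s < x)%R%:R) =
      (fun x => 1 + (- xi) * (if (s < x)%R then 1 else 0 : R)%:C).
    by apply/funext => x; case: ifP => _; rewrite ?mulr0 ?mulr1 ?mulNr ?oppr0.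
  apply: cmeasurableD; first exact: cmeasurable_cst.
  apply: cmeasurableM; first exact: cmeasurable_cst.
  apply: cmeasurable_real; apply: measurable_funTS; apply: measurable_fun_ifT => //.
  exact: measurable_fun_ltr.
apply: cmeasurableM.
  apply: cmeasurable_real; apply: measurable_funTS; exact: measurable_powR.
split; apply: measurable_funTS.
- apply: (measurableT_comp (continuous_measurable_fun (@continuous_cos R))).
  by apply: measurable_funM => //; exact: measurable_ln.
- apply: (measurableT_comp (continuous_measurable_fun (@continuous_sin R))).
  by apply: measurable_funM => //; exact: measurable_ln.
Qed.

Lemma weight_cauchyE xi s a j m y x : 0 < y -> 0 < x ->
  weight xi s a x * (cauchy_factor j m y x)%:C = (1 - xi * (s < x)%R%:R) *
  ((ray_fun (complex.Re a + 1 + j%:R) m y x / x)%:C * phase (complex.Im a) x).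
Proof. by move=> y0 x0; rewrite -gamma_rayE// /weight !mulrA. Qed.

(** The jump factor is bounded by [1 + norm1 xi], the phase by 2 and [q] by [k * (x + 1)], which
    leaves the integrand of [integrable_ray_fun]. *)
Lemma cintegrable_weight xi s a j m y (q : R -> R[i]) k :
  -1 < complex.Re a -> 0 < y -> cmeasurable H q ->
  (forall x, 0 < x -> norm1 (q x) <= k * (x + 1)) ->
  cintegrable leb H (fun x => weight xi s a x * (cauchy_factor j m y x)%:C * q x).
Proof.
move=> ha y0 mq hq.
have p0 : 0 < complex.Re a + 1 + j%:R by rewrite ltr_wpDr// -ltrBlDr sub0r.
have := integrableZl (@measurable_half_line R) ((1 + norm1 xi) * 2 * k)
  (integrable_ray_fun m p0 y0).
move=> ig; apply: (cintegrable_le _ _ ig); first exact: measurable_half_line.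
- apply: cmeasurableM => //; apply: cmeasurableM; first exact: cmeasurable_weight.
  by apply: cmeasurable_real; apply: measurable_cauchy_factor; exact: ltW.
move=> x /half_lineP x0; rewrite weight_cauchyE//.
have r0 : 0 <= ray_fun (complex.Re a + 1 + j%:R) m y x / x.
  by rewrite divr_ge0 ?expR_ge0// ltW.
apply: (le_trans (norm1M _ _)).
have -> : (1 + norm1 xi) * 2 * k *
    (ray_fun (complex.Re a + 1 + j%:R) m y x * ((x + 1) / x)) =
  (1 + norm1 xi) * (ray_fun (complex.Re a + 1 + j%:R) m y x / x * 2) * (k * (x + 1)).
  by ring.
apply: ler_pM; rewrite ?norm1_ge0//; last exact: hq.
apply: (le_trans (norm1M _ _)); apply: ler_pM; rewrite ?norm1_ge0//.
  apply: (le_trans (norm1D _ _)); apply: lerD.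
    by rewrite /norm1 /= normr1 normr0 addr0.
  case: (s < x); first by rewrite mulr1 norm1N.
  by rewrite mulr0n mulr0 oppr0 -[0](rmorph0 (real_complex R)) norm1_real normr0 norm1_ge0.
apply: (le_trans (norm1M _ _)); rewrite norm1_real ger0_norm//.
by rewrite ler_wpM2l// norm1_phase.
Qed.

End weighted_rays.

Section ray_integrals.
Context {R : realType}.
Implicit Types (a xi : R[i]) (p b x y s c : R) (j m : nat).
Local Notation H := (@half_line R).
Local Notation leb := (@leb R).

Lemma continuous_ray_wave (u u' : R -> R) b p m y x : 0 < y -> 0 < x ->
  continuous u -> continuous u' ->
  {for x, continuous (fun x => ray_fun p m y x / x *
    (u (b * ln x) * (p - x - m%:R * x / (x + y)) + u' (b * ln x) * b))}.
Proof.
move=> y0 x0 cu cu'; have xy0 : 0 < x + y by rewrite addr_gt0.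
have cr : {for x, continuous (ray_fun p m y)}.
  apply: continuous_comp; last exact: continuous_expR.
  apply: differentiable_continuous; apply/derivable1_diffP.
  by have [] := is_derive_ray_exponent p m y0 x0.
have cl : {for x, continuous (fun x => b * ln x)}.
  by apply: cvgM; [exact: cvg_cst|exact: continuous_ln].
have cw (w : R -> R) : continuous w -> {for x, continuous (fun x => w (b * ln x))}.
  by move=> cw; exact: (@continuous_comp _ _ _ (fun x => b * ln x) w _ cl (cw _)).
apply: cvgM.
  by apply: cvgM => //; apply: cvgV; [rewrite gt_eqF|exact: cvg_id].
apply: cvgD; last by apply: cvgM; [exact: cw|exact: cvg_cst].
apply: cvgM; first exact: cw.
apply: cvgB; first by apply: cvgB; [exact: cvg_cst|exact: cvg_id].
apply: cvgM; first by apply: cvgM; [exact: cvg_cst|exact: cvg_id].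
apply: cvgV; first by rewrite gt_eqF.
by apply: cvgD; [exact: cvg_id|exact: cvg_cst].
Qed.

(* u is cos or sin: these are the two parts of x^(i b) = exp (i b ln x). *)
Lemma ray_wave_integral (u u' : R -> R) b p m y c : 0 < p -> 0 < y -> 0 <= c ->
  (forall z : R, is_derive z 1 u (u' z)) -> continuous u' -> (forall z, `|u z| <= 1) ->
  let f x := ray_fun p m y x / x *
    (u (b * ln x) * (p - x - m%:R * x / (x + y)) + u' (b * ln x) * b) in
  leb.-integrable `]c, +oo[ (EFin \o f) ->
  \int[leb]_(x in `]c, +oo[) f x = - (if c == 0 then 0 else u (b * ln c) * ray_fun p m y c).
Proof.
move=> p0 y0 c0 du cu' u1 f fi.
have cu : continuous u.
  move=> z; apply: differentiable_continuous; apply/derivable1_diffP.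
  by have [] := du z.
have [h0 h1] := ray_fun_cvg0 m p0 y0 c0.
pose F z := u (b * ln z) * ray_fun p m y z.
have r0 z : 0 <= ray_fun p m y z by exact: expR_ge0.
have F0 (v : nat -> R) : ray_fun p m y (v n) @[n --> \oo] --> 0 ->
    F (v n) @[n --> \oo] --> 0.
  move=> h; apply/norm_cvg0P.
  apply: (@squeeze_cvgr _ _ _ _ (cst 0) (fun n => ray_fun p m y (v n))) => //.
    by apply: nearW => n; rewrite normr_ge0 /= normrM (ger0_norm (r0 _)) ler_piMl.
  exact: cvg_cst.
rewrite -[RHS]add0r.
apply: (primitive_integral (F := F)) => //.
- by move=> x cx; apply: is_derive_ray_wave => //; exact: le_lt_trans cx.
- by move=> x cx; apply: continuous_ray_wave => //; exact: le_lt_trans cx.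
(* At [c = 0] the formula for [F] involves the default value of [ln 0], so the lower limit comes
   from [ray_fun_cvg0] instead of continuity. *)
- case: eqP => [->|/eqP cn0].
    by under eq_fun do rewrite add0r; exact: F0.
  have {}c0 : 0 < c by rewrite lt_neqAle eq_sym cn0.
  have cF : {for c, continuous F}.
    apply: differentiable_continuous; apply/derivable1_diffP.
    by have [] := is_derive_ray_wave b p m y0 c0 du.
  have h : (c + n.+1%:R^-1 : R) @[n --> \oo] --> c + 0.
    by apply: cvgD; [exact: cvg_cst|exact: cvg_harmonic].
  by rewrite addr0 in h; exact: (cvg_comp _ _ h cF).
- exact: F0.
Qed.

(* For h x = x^j / (x + y)^m, the derivative of x^(a+1) e^(-x) h(x) is
   x^a e^(-x) h(x) ibp_factor(x). *)
Definition ibp_factor a j m y x : R[i] :=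
  a + 1 + j%:R - x%:C - (m%:R * x / (x + y))%:C.

Lemma ibp_factor_parts a j m y x :
  ibp_factor a j m y x = (complex.Re a + 1 + j%:R - x - m%:R * x / (x + y)) +i* complex.Im a.
Proof.
rewrite /ibp_factor -[j%:R](rmorph_nat (real_complex R)); apply: complex_eqP;
  by case: a => u v /=; rewrite ?subr0 ?addr0.
Qed.

Lemma norm1_ibp_factor a j m y x : 0 < y -> 0 < x ->
  norm1 (ibp_factor a j m y x) <= (norm1 a + 1 + j%:R + m%:R) * (x + 1).
Proof.
move=> y0 x0; rewrite ibp_factor_parts /norm1 /=.
have q01 : 0 <= m%:R * x / (x + y) <= m%:R.
  rewrite divr_ge0 ?mulr_ge0 ?addr_ge0 ?(ltW x0) ?(ltW y0)//=.
  by rewrite ler_pdivrMr ?addr_gt0// ler_wpM2l// lerDl ltW.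
have j0 : 0 <= j%:R :> R by [].
move: q01 j0; set q := _ / _; set M := m%:R : R; set J := j%:R : R => /andP[q0 q1] J0.
have h1 : `|complex.Re a + 1 + J - x - q| <= `|complex.Re a| + 1 + J + x + q.
  have := ler_norm (complex.Re a); have := ler_norm (- complex.Re a); rewrite normrN.
  by move=> ? ?; rewrite ler_norml; apply/andP; split; lra.
apply: (le_trans (lerD h1 (lexx _))).
have := normr_ge0 (complex.Re a); have := normr_ge0 (complex.Im a).
set A := `|complex.Re a|; set B := `|complex.Im a| => B0 A0.
have : 0 <= (A + B + J + M) * x by rewrite mulr_ge0 ?addr_ge0// ltW.
by have := le_trans q0 q1; lra.
Qed.

Lemma cmeasurable_ibp_factor a j m y : 0 <= y -> cmeasurable H (ibp_factor a j m y).
Proof.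
move=> y0; apply: (eq_cmeasurable (f := fun x => a + 1 + j%:R + (- x - m%:R * (x * (x + y)^-1))%:C)).
  by move=> x _; rewrite /ibp_factor rmorphB rmorphN /= addrA mulrA.
apply: cmeasurableD; first exact: cmeasurable_cst.
apply: cmeasurable_real; apply: measurable_funB; first by apply: measurable_funN.
by apply: measurable_funM => //; apply: measurable_funM => //; exact: measurable_inv_half_line.
Qed.

Lemma cintegrable_weight_ibp xi s a j m y : -1 < complex.Re a -> 0 < y ->
  cintegrable leb H
    (fun x => weight xi s a x * (cauchy_factor j m y x)%:C * ibp_factor a j m y x).
Proof.
move=> ha y0; apply: (cintegrable_weight xi s j m ha y0).
  by apply: cmeasurable_ibp_factor; exact: ltW.
by move=> x x0; exact: norm1_ibp_factor.
Qed.

Lemma gamma_ray_integral a j m y c : -1 < complex.Re a -> 0 < y -> 0 <= c ->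
  cintegral leb `]c, +oo[ (fun x => cpow x a * (expR (- x))%:C
    * (cauchy_factor j m y x)%:C * ibp_factor a j m y x) =
  - (cpow c (a + 1) * (expR (- c))%:C * (cauchy_factor j m y c)%:C).
Proof.
move=> ha y0 c0.
have p0 : 0 < complex.Re a + 1 + j%:R by rewrite ltr_wpDr// -ltrBlDr sub0r.
have cH : `]c, +oo[ `<=` H.
  move=> x /=; rewrite in_itv/= andbT => cx; apply/half_lineP; exact: le_lt_trans cx.
have cm : measurable (`]c, +oo[ : set (measurableTypeR R)) by exact: measurable_itv.
(* With [xi = 0] the weight has no jump and is x^a e^(-x). *)
have := cintegrable_weight_ibp 0 c j m ha y0.
set p := complex.Re a + 1 + j%:R in p0 *; set b := complex.Im a.
pose G x : R[i] := (ray_fun p m y x / x * (cos (b * ln x) * (p - x - m%:R * x / (x + y))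
      + - sin (b * ln x) * b)) +i*
    (ray_fun p m y x / x * (sin (b * ln x) * (p - x - m%:R * x / (x + y))
      + cos (b * ln x) * b)).
have wE x : H x -> weight 0 c a x * (cauchy_factor j m y x)%:C * ibp_factor a j m y x = G x.
  move=> /half_lineP x0; rewrite weight_cauchyE// mul0r subr0 mul1r ibp_factor_parts.
  rewrite /phase /G -/p -/b; apply: complex_eqP; rewrite /= ?mul0r ?addr0 ?subr0; ring.
move=> /(eq_cintegrable measurable_half_line wE)[i1 i2].
have {}i1 := integrableS measurable_half_line cm cH i1.
have {}i2 := integrableS measurable_half_line cm cH i2.
transitivity (cintegral leb `]c, +oo[ G).
  by apply: eq_cintegral => x /cH /wE <-; rewrite /weight mul0r subr0 mul1r.
rewrite /cintegral.
have cNs : continuous (fun z : R => - sin z).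
  by move=> z; apply: cvgN; exact: continuous_sin.
have cos1 z : `|cos z : R| <= 1 by rewrite ler_norml cos_geN1 cos_le1.
have sin1 z : `|sin z : R| <= 1 by rewrite ler_norml sin_geN1 sin_le1.
have -> : \int[leb]_(x in `]c, +oo[) (complex.Re (R:=R) \o G) x =
    - (if c == 0 then 0 else cos (b * ln c) * ray_fun p m y c).
  exact: (ray_wave_integral p0 y0 c0 (@is_derive_cos R) cNs cos1 i1).
have -> : \int[leb]_(x in `]c, +oo[) (complex.Im (R:=R) \o G) x =
    - (if c == 0 then 0 else sin (b * ln c) * ray_fun p m y c).
  exact: (ray_wave_integral p0 y0 c0 (@is_derive_sin R) (@continuous_cos R) sin1 i2).
case: eqP => [->|/eqP cn0].
  rewrite /cpow powR0 ?mul0r ?oppr0// complex_ReD /=.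
  by rewrite gt_eqF// -ltrBlDr sub0r.
have {}c0 : 0 < c by rewrite lt_neqAle eq_sym cn0.
rewrite ray_cpowE//; apply: complex_eqP => /=; rewrite ?mul0r ?subr0 ?addr0 mulrC//.
Qed.

(** The weight is x^a e^(-x) minus [xi] times its restriction to x > s. The first part integrates to
    0, its boundary values being 0; the second leaves the boundary value at [s]. *)
Lemma weight_ibp xi s a j m y : -1 < complex.Re a -> 0 < y -> 0 < s ->
  cintegral leb H
    (fun x => weight xi s a x * (cauchy_factor j m y x)%:C * ibp_factor a j m y x) =
  xi * cpow s (a + 1) * (expR (- s))%:C * (cauchy_factor j m y s)%:C.
Proof.
move=> ha y0 s0.
pose f x := cpow x a * (expR (- x))%:C * (cauchy_factor j m y x)%:C * ibp_factor a j m y x.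
have fi : cintegrable leb H f.
  apply: eq_cintegrable (cintegrable_weight_ibp 0 s j m ha y0); first exact: measurable_half_line.
  by move=> x _; rewrite /weight mul0r subr0 mul1r.
have f0 : cintegral leb H f = 0.
  rewrite /H /half_line (gamma_ray_integral j m ha y0 (lexx 0)) /cpow powR0 ?mul0r ?oppr0//.
  by rewrite complex_ReD /= gt_eqF// -ltrBlDr sub0r.
have sH : `]s, +oo[ `<=` H.
  move=> x /=; rewrite in_itv/= andbT => sx; apply/half_lineP; exact: lt_trans sx.
pose g x := if s < x then f x else 0.
have memE x : (x \in (`]s, +oo[%classic : set R)) = (s < x).
  by apply/idP/idP; rewrite inE/= in_itv/= andbT.
have gE : cintegral leb H g = cintegral leb `]s, +oo[ f.
  rewrite /cintegral -(setIidr sH) !Rintegral_mkcondr; congr (_ +i* _);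
    by apply: eq_Rintegral => x _; rewrite patchE memE /g /=; case: ifP.
have gi : cintegrable leb H g.
  apply: (@cintegrable_dominated _ _ _ leb H measurable_half_line g f 1) => //.
  - apply: (eq_cmeasurable (f := fun x => (if s < x then 1 else 0)%:C * f x)).
      by move=> x _; rewrite /g; case: ifP => _; rewrite ?mul1r ?mul0r.
    apply: cmeasurableM; last exact: cintegrable_measurable fi.
    apply: cmeasurable_real; apply: measurable_funTS; apply: measurable_fun_ifT => //.
    exact: measurable_fun_ltr.
  - move=> x _; rewrite mul1r /g; case: ifP => // _.
    by rewrite -[0](rmorph0 (real_complex R)) norm1_real normr0 norm1_ge0.
transitivity (cintegral leb H (fun x => - xi * g x + f x)).
  apply: eq_cintegral => x _; by rewrite /g /f /weight; case: ifP => _; rewrite ?mulr1n ?mulr0n; ring.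
rewrite (cintegral_lin measurable_half_line _ gi fi) gE f0 addr0.
by rewrite (gamma_ray_integral j m ha y0 (ltW s0)) mulrNN !mulrA.
Qed.

End ray_integrals.

Lemma poly_span_ind (K : fieldType) (C : {poly K} -> Prop) :
  C 0 -> (forall p q, C p -> C q -> C (p + q)) -> (forall c k, C (c *: 'X^k)) ->
  forall p, C p.
Proof.
by move=> C0 CD CX p; rewrite -[p]coefK poly_def; elim/big_ind: _.
Qed.

(** * Integrals as linear functionals on polynomials, [e] being the identity or a coordinate of the
    quadrant *)

Section polynomial_integrals.
Context d (T : measurableType d) (R : realType).
Variables (mu : {measure set T -> \bar R}) (D : set T) (mD : measurable D).
Variables (w : T -> R[i]) (e : T -> R).
Hypothesis wi : forall k, cintegrable mu D (fun x => w x * monomial k (e x)).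

Lemma cintegrable_peval p : cintegrable mu D (fun x => w x * peval p (e x)).
Proof.
elim/poly_span_ind: p => [|p q hp hq|c k].
- apply: eq_cintegrable (cintegrableZ mD 0 (wi 0)) => // x _.
  by rewrite /peval horner0 mul0r mulr0.
- apply: eq_cintegrable (cintegrableD mD hp hq) => // x _.
  by rewrite /peval hornerD mulrDr.
- apply: eq_cintegrable (cintegrableZ mD c (wi k)) => // x _.
  by rewrite /peval /monomial hornerZ hornerXn mulrCA.
Qed.

Lemma scalar_cintegral_peval :
  scalar (fun p => cintegral mu D (fun x => w x * peval p (e x))).
Proof.
move=> c p q; rewrite -(cintegral_lin mD)//; try exact: cintegrable_peval.
by apply: eq_cintegral => x _; rewrite /peval hornerD hornerZ mulrDr mulrCA.
Qed.

End polynomial_integrals.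

Section weight_functionals.
Context {R : realType}.
Variables (a xi : R[i]) (s : R).
Hypotheses (ha : -1 < complex.Re a) (hs : 0 < s).
Local Notation H := (@half_line R).
Local Notation leb := (@leb R).
Local Notation w := (weight xi s a).

Lemma cintegrable_weight_cauchy j m y : 0 < y ->
  cintegrable leb H (fun x => w x * (cauchy_factor j m y x)%:C).
Proof.
move=> y0.
have := @cintegrable_weight _ xi s a j m y (fun=> 1) 1 ha y0 (cmeasurable_cst _ _).
have h x : 0 < x -> norm1 (1 : R[i]) <= 1 * (x + 1).
  by move=> x0; rewrite /norm1 /= normr1 normr0 addr0 mul1r lerDr ltW.
move=> /(_ h); apply: eq_cintegrable; first exact: measurable_half_line.
by move=> x _; rewrite mulr1.
Qed.

Lemma cauchy_factor0 j (y x : R) : (cauchy_factor j 0 y x)%:C = monomial j x.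
Proof. by rewrite /cauchy_factor expr0 divr1 rmorphXn. Qed.

Lemma cintegrable_weight_monomial k :
  cintegrable leb H (fun x => w x * monomial k x).
Proof.
apply: eq_cintegrable (cintegrable_weight_cauchy k 0 ltr01); first exact: measurable_half_line.
by move=> x _; rewrite cauchy_factor0.
Qed.

Lemma cauchy_kernelE (y x : R) j : 0 < y -> 0 < x ->
  (- y%:C - x%:C)^-1 * monomial j x = - (cauchy_factor j 1 y x)%:C.
Proof.
move=> y0 x0; rewrite /cauchy_factor expr1 -opprD -rmorphD /= invrN mulNr addrC.
by rewrite rmorphM rmorphXn /= fmorphV mulrC.
Qed.

Lemma cintegrable_cauchy_kernel y k : 0 < y ->
  cintegrable leb H (fun x => w x / (- y%:C - x%:C) * monomial k x).
Proof.
move=> y0.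
apply: eq_cintegrable (cintegrableZ measurable_half_line (-1) (cintegrable_weight_cauchy k 1 y0)).
  exact: measurable_half_line.
move=> x /half_lineP x0; rewrite -[RHS]mulrA cauchy_kernelE//; ring.
Qed.

Lemma scalar_weight_integral : scalar (weight_integral w).
Proof. exact: (scalar_cintegral_peval measurable_half_line cintegrable_weight_monomial). Qed.

Lemma scalar_cauchy_transform y : 0 < y ->
  scalar (fun p => cauchy_transform w p (- y%:C)).
Proof.
move=> y0.
exact: (scalar_cintegral_peval measurable_half_line (fun k => cintegrable_cauchy_kernel k y0)).
Qed.

(** Under the integral this is - y / (- y - x) = 1 + x / (- y - x). *)
Lemma cauchy_transformX y p : 0 < y ->
  - y%:C * cauchy_transform w p (- y%:C) =
  weight_integral w p + cauchy_transform w ('X * p) (- y%:C).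
Proof.
move=> y0.
have i1 := cintegrable_peval measurable_half_line cintegrable_weight_monomial p.
have i2 q := cintegrable_peval measurable_half_line (fun k => cintegrable_cauchy_kernel k y0) q.
rewrite /cauchy_transform -(cintegralZ measurable_half_line)// -(cintegralD measurable_half_line)//.
apply: eq_cintegral => x /half_lineP x0; rewrite /peval hornerM hornerX.
have yx0 : - y%:C - x%:C != 0.
  by rewrite -opprD oppr_eq0 -rmorphD /= (inj_eq (@complexI R)) gt_eqF// addr_gt0.
by field.
Qed.

Lemma mulX_derivXn k : 'X * ('X^k : {poly R[i]})^`() = k%:R *: 'X^k.
Proof. by case: k => [|k]; rewrite derivXn ?mulr0n ?mulr0 ?scale0r// mulrnAr -exprS scaler_nat. Qed.

(** Both sides are linear in [p], so powers of x suffice; these are [weight_ibp] with [m = 0], where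
    the shift [y] is immaterial and is taken to be 1. *)
Lemma weight_integral_ibp p :
  weight_integral w ('X * p^`()) + (a + 1) * weight_integral w p
  - weight_integral w ('X * p) =
  xi * cpow s (a + 1) * (expR (- s))%:C * p.[s%:C].
Proof.
have L := scalar_weight_integral.
pose l1 p := weight_integral w ('X * p^`()) + (a + 1) * weight_integral w p
  - weight_integral w ('X * p).
pose l2 (p : {poly R[i]}) := xi * cpow s (a + 1) * (expR (- s))%:C * p.[s%:C].
suff : l1 =1 l2 by exact.
apply: scalar_poly_eq => [c u v|c u v|k]; rewrite /l1 /l2.
- by rewrite derivD derivZ !mulrDr -!scalerAr !L; ring.
- by rewrite hornerD hornerZ; ring.
rewrite mulX_derivXn (scalar_formZ L) hornerXn.
have := weight_ibp xi k 0 ha ltr01 hs; rewrite cauchy_factor0 /monomial => <-.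
have i q := cintegrable_peval measurable_half_line cintegrable_weight_monomial q.
have Zi c q := cintegrableZ measurable_half_line c (i q).
rewrite -mulrDl [k%:R + _]addrC -[- _]mulN1r /weight_integral.
rewrite -!(cintegralZ measurable_half_line)//.
rewrite -(cintegralD measurable_half_line); [|exact: Zi|exact: Zi].
apply: eq_cintegral => x _; rewrite cauchy_factor0 /ibp_factor /peval mul0r mul0r.
rewrite rmorph0 subr0 hornerM hornerX hornerXn /monomial; ring.
Qed.

End weight_functionals.

(** * The pairing of the two weights *)

Section bimoment_functionals.
Context {R : realType}.
Variables (a b xi psi : R[i]) (s t : R).
Hypotheses (ha : -1 < complex.Re a) (hb : -1 < complex.Re b).
Hypotheses (hs : 0 < s) (ht : 0 < t).
Local Notation H := (@half_line R).
Local Notation leb := (@leb R).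
Local Notation leb2 := (@leb2 R).
Local Notation w1 := (weight xi s a).
Local Notation w2 := (weight psi t b).
Hypothesis hM : forall j k, pairing_finite w1 w2 (@monomial R j) (@monomial R k).
Local Notation B f g := (pairing w1 w2 (peval f) (peval g)).
Local Notation mQ := (@measurable_quadrant R).

(** Finiteness and linearity pass from monomials to polynomials in one variable at a time, so the
    integrand is regrouped with the active monomial last. *)
Let hMl k j : cintegrable leb2 (H `*` H)
  (fun p => w1 p.1 * w2 p.2 / (p.1 + p.2)%:C * monomial k p.2 * monomial j p.1).
Proof.
apply: eq_cintegrable (hM j k); first exact: mQ.
by move=> p _; rewrite /pairing_integrand mulrAC.
Qed.

Let hMr f k : cintegrable leb2 (H `*` H)
  (fun p => w1 p.1 * w2 p.2 / (p.1 + p.2)%:C * peval f p.1 * monomial k p.2).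
Proof.
apply: eq_cintegrable (cintegrable_peval mQ (hMl k) f); first exact: mQ.
by move=> p _; rewrite mulrAC.
Qed.

Lemma pairing_finite_peval f g : pairing_finite w1 w2 (peval f) (peval g).
Proof. exact: (cintegrable_peval mQ (hMr f)). Qed.

Lemma scalar_pairing_r f : scalar (fun g => B f g).
Proof. exact: (scalar_cintegral_peval mQ (hMr f)). Qed.

Let hMl' g k : cintegrable leb2 (H `*` H)
  (fun p => w1 p.1 * w2 p.2 / (p.1 + p.2)%:C * peval g p.2 * monomial k p.1).
Proof.
apply: eq_cintegrable (pairing_finite_peval 'X^k g); first exact: mQ.
by move=> p _; rewrite /pairing_integrand mulrAC /monomial /peval hornerXn.
Qed.

Lemma scalar_pairing_l g : scalar (fun f => B f g).
Proof.
move=> c f f'; have := scalar_cintegral_peval mQ (hMl' g) c f f'.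
by congr (_ = _ * _ + _); apply: eq_cintegral => p _; rewrite /pairing_integrand mulrAC.
Qed.

(** The factor x + y cancels the denominator, and the double integral splits into a product by
    Fubini. *)
Lemma pairing_mulX f g :
  B ('X * f) g + B f ('X * g) = weight_integral w1 f * weight_integral w2 g.
Proof.
have i1 := cintegrable_peval (@measurable_half_line R) (cintegrable_weight_monomial xi s ha) f.
have i2 := cintegrable_peval (@measurable_half_line R) (cintegrable_weight_monomial psi t hb) g.
pose F p := w1 p.1 * peval f p.1 * (w2 p.2 * peval g p.2).
have FE p : (H `*` H) p -> pairing_integrand w1 w2 (peval ('X * f)) (peval g) p +
    pairing_integrand w1 w2 (peval f) (peval ('X * g)) p = F p.
  case: p => x y [/= /half_lineP x0 /half_lineP y0].
  have xy0 : (x + y)%:C != 0 :> R[i] by rewrite (inj_eq (@complexI R)) gt_eqF// addr_gt0.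
  rewrite /pairing_integrand /F /peval /= !hornerM !hornerX.
  by rewrite rmorphD /= in xy0 *; field.
have j1 := pairing_finite_peval ('X * f) g; have j2 := pairing_finite_peval f ('X * g).
rewrite /pairing -(cintegralD mQ)//.
transitivity (cintegral leb2 (H `*` H) F); first exact: eq_cintegral.
rewrite cintegral_fubini12; last exact: (eq_cintegrable mQ FE (cintegrableD mQ j1 j2)).
rewrite mulrC /weight_integral -(cintegralZ (@measurable_half_line R))//.
by apply: eq_cintegral => x _; rewrite /F /= (cintegralZ (@measurable_half_line R))// mulrC.
Qed.

(** Up to sign, the contribution of x d/dx acting on the kernel 1 / (x + y). *)
Definition ratio_moment j k := cintegral leb2 (H `*` H)
  (fun p => (p.1 / (p.1 + p.2))%:C * pairing_integrand w1 w2 (@monomial R j) (@monomial R k) p).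

Lemma cintegrable_ratio j k : cintegrable leb2 (H `*` H)
  (fun p => (p.1 / (p.1 + p.2))%:C * pairing_integrand w1 w2 (@monomial R j) (@monomial R k) p).
Proof.
apply: (@cintegrable_dominated _ _ _ leb2 (H `*` H) mQ _ _ 1 _ (hM j k)).
  apply: cmeasurableM; last exact: cintegrable_measurable (hM j k).
  apply: cmeasurable_real.
  (* On the quadrant 1 / (x + y) equals exp (- ln (x + y)), which is measurable on the whole
     plane. *)
  apply: (eq_measurable_fun (fun p : R * R => p.1 * expR (- ln (p.1 + p.2)))).
    move=> [x y]; rewrite inE => -[/= /half_lineP x0 /half_lineP y0].
    by rewrite expRN lnK// posrE addr_gt0.
  apply: measurable_funTS; apply: measurable_funM => //.
  apply: (measurableT_comp (@measurable_expR R)); apply: measurable_funN.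
  by apply: (measurableT_comp (@measurable_ln R)); exact: measurable_funD.
move=> [x y] [/= /half_lineP x0 /half_lineP y0].
rewrite (le_trans (norm1M _ _))// ler_wpM2r ?norm1_ge0// norm1_real.
have xy0 : 0 < x + y by rewrite addr_gt0.
rewrite ger0_norm; last by apply: divr_ge0; exact: ltW.
by rewrite ler_pdivrMr// mul1r lerDl ltW.
Qed.

(** For fixed y, integrate by parts in x against x^j / (x + y). The jump leaves s^j / (s + y), whose
    integral against the second weight in y is minus s^j times a Cauchy transform at - s. *)
Lemma pairing_ibp j k :
  (a + 1 + j%:R) * B ('X^j) ('X^k) - B ('X^(j.+1)) ('X^k) - ratio_moment j k =
  - (xi * cpow s (a + 1) * (expR (- s))%:C * s%:C ^+ j *
     cauchy_transform w2 ('X^k) (- s%:C)).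
Proof.
have BE j' k' : B ('X^j') ('X^k') = pairing w1 w2 (@monomial R j') (@monomial R k').
  by apply: eq_cintegral => p _; rewrite /pairing_integrand /peval !hornerXn.
pose A := xi * cpow s (a + 1) * (expR (- s))%:C.
pose F p := (a + 1 + j%:R) * pairing_integrand w1 w2 (@monomial R j) (@monomial R k) p +
  ((-1) * pairing_integrand w1 w2 (@monomial R j.+1) (@monomial R k) p +
  (-1) * ((p.1 / (p.1 + p.2))%:C * pairing_integrand w1 w2 (@monomial R j) (@monomial R k) p)).
have i1 := cintegrableZ mQ (-1) (cintegrable_ratio j k).
have i2 := cintegrable_lin mQ (-1) (hM j.+1 k) i1.
have iF : cintegrable leb2 (H `*` H) F := cintegrable_lin mQ _ (hM j k) i2.
have eF : cintegral leb2 (H `*` H) F =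
    (a + 1 + j%:R) * B ('X^j) ('X^k) - B ('X^(j.+1)) ('X^k) - ratio_moment j k.
  rewrite (cintegral_lin mQ _ (hM j k) i2) (cintegral_lin mQ _ (hM j.+1 k) i1).
  rewrite (cintegralZ mQ _ (cintegrable_ratio j k)) !BE !mulN1r addrA //.
rewrite -eF cintegral_fubini21//.
transitivity (cintegral leb H (fun y =>
    (- (A * s%:C ^+ j)) * (w2 y / (- s%:C - y%:C) * monomial k y))).
  apply: eq_cintegral => y /half_lineP y0.
  have iw := cintegrable_weight_ibp xi s j 1 ha y0.
  transitivity (cintegral leb H (fun x => w2 y * monomial k y *
      (w1 x * (cauchy_factor j 1 y x)%:C * ibp_factor a j 1 y x))).
    apply: eq_cintegral => x /half_lineP x0; rewrite /F /pairing_integrand /=.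
    have xy0 : (x + y)%:C != 0 :> R[i] by rewrite (inj_eq (@complexI R)) gt_eqF// addr_gt0.
    rewrite /cauchy_factor /ibp_factor /monomial expr1 mul1r !rmorphM /= !rmorphXn /= !fmorphV.
    by rewrite exprS; field; rewrite -rmorphD.
  rewrite (cintegralZ (@measurable_half_line R))// weight_ibp// -/A.
  have sy0 : (s + y)%:C != 0 :> R[i] by rewrite (inj_eq (@complexI R)) gt_eqF// addr_gt0.
  rewrite -opprD -rmorphD /= /cauchy_factor expr1 rmorphM rmorphXn /= fmorphV.
  by field; rewrite -rmorphD sy0.
rewrite (cintegralZ (@measurable_half_line R)); last exact: cintegrable_cauchy_kernel.
rewrite mulNr; congr (- (_ * _)).
by apply: eq_cintegral => y _; rewrite /peval hornerXn.
Qed.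

End bimoment_functionals.

Section pairing_swap.
Context {R : realType}.
Variables (w1 w2 f g : R -> R[i]).
Hypothesis fin : pairing_finite w1 w2 f g.

Lemma pairing_integrand_swap (p : R * R) :
  pairing_integrand w1 w2 f g (swap p) = pairing_integrand w2 w1 g f p.
Proof. by rewrite /pairing_integrand /= addrC; ring. Qed.

Lemma pairing_finite_swap : pairing_finite w2 w1 g f.
Proof.
apply: (eq_cintegrable (@measurable_quadrant R) _ (cintegrable_swap fin)) => p _.
exact: pairing_integrand_swap.
Qed.

Lemma pairing_swap : pairing w2 w1 g f = pairing w1 w2 f g.
Proof.
rewrite [RHS]/pairing -(cintegral_swap fin); apply: eq_cintegral => p _.
by rewrite /= pairing_integrand_swap.
Qed.

End pairing_swap.

Section pairing_derivative.
Context {R : realType}.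
Variables (a b xi psi : R[i]) (s t : R).
Hypotheses (ha : -1 < complex.Re a) (hb : -1 < complex.Re b).
Hypotheses (hs : 0 < s) (ht : 0 < t).
Local Notation H := (@half_line R).
Local Notation leb2 := (@leb2 R).
Local Notation w1 := (weight xi s a).
Local Notation w2 := (weight psi t b).
Hypothesis hM : forall j k, pairing_finite w1 w2 (@monomial R j) (@monomial R k).
Local Notation B f g := (pairing w1 w2 (peval f) (peval g)).

Let hM' j k : pairing_finite w2 w1 (@monomial R j) (@monomial R k).
Proof. exact/pairing_finite_swap/hM. Qed.

(* x / (x + y) + y / (x + y) = 1 *)
Lemma ratio_moment_swap j k :
  ratio_moment a b xi psi s t j k + ratio_moment b a psi xi t s k j = B ('X^j) ('X^k).
Proof.
have mQ := @measurable_quadrant R.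
have i1 := cintegrable_ratio hM j k; have i2 := cintegrable_ratio hM' k j.
have i2' := cintegrable_swap i2.
rewrite /ratio_moment -(cintegral_swap i2) -(cintegralD mQ)//.
apply: eq_cintegral => -[x y] [/= /half_lineP x0 /half_lineP y0].
have xy0 : (x + y)%:C != 0 :> R[i] by rewrite (inj_eq (@complexI R)) gt_eqF// addr_gt0.
rewrite /pairing_integrand /peval /monomial /= !hornerXn [y + x]addrC !rmorphM /= !fmorphV.
by rewrite rmorphD /= in xy0 *; field.
Qed.

(** By bilinearity monomials suffice. There, add [pairing_ibp] in the two variables: the ratio
    moments sum to the pairing itself, and the terms with a raised exponent combine by
    [pairing_mulX]. *)
Lemma pairing_deriv f g :
  B ('X * f^`()) g + B f ('X * g^`()) + (a + b + 1) * B f g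
  - weight_integral w1 f * weight_integral w2 g
  + xi * cpow s (a + 1) * (expR (- s))%:C * f.[s%:C] * cauchy_transform w2 g (- s%:C)
  + psi * cpow t (b + 1) * (expR (- t))%:C * cauchy_transform w1 f (- t%:C) * g.[t%:C]
  = 0.
Proof.
have Bl := scalar_pairing_l hM; have Br := scalar_pairing_r hM.
have L1 := scalar_weight_integral xi s ha.
have L2 := scalar_weight_integral psi t hb.
have C1 := scalar_cauchy_transform xi s ha ht.
have C2 := scalar_cauchy_transform psi t hb hs.
pose Phi f g := B ('X * f^`()) g + B f ('X * g^`()) + (a + b + 1) * B f g
  - weight_integral w1 f * weight_integral w2 g
  + xi * cpow s (a + 1) * (expR (- s))%:C * f.[s%:C] * cauchy_transform w2 g (- s%:C)
  + psi * cpow t (b + 1) * (expR (- t))%:C * cauchy_transform w1 f (- t%:C) * g.[t%:C].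
have Phi_l g' : scalar (Phi^~ g').
  move=> c u v; rewrite /Phi derivD derivZ mulrDr -scalerAr.
  by rewrite !Bl L1 C1 hornerD hornerZ; ring.
have Phi_r f' : scalar (Phi f').
  move=> c u v; rewrite /Phi derivD derivZ mulrDr -scalerAr.
  by rewrite !Br L2 C2 hornerD hornerZ; ring.
have scalar_0 : scalar (fun _ : {poly R[i]} => 0 : R[i]).
  by move=> c u v; rewrite mulr0 addr0.
suff mono j k : Phi ('X^j) ('X^k) = 0.
  apply: (scalar_poly_eq (Phi_r f) scalar_0) => k.
  exact: (scalar_poly_eq (Phi_l ('X^k)) scalar_0).
have e1 := pairing_ibp ha hb hs hM j k.
have e2 := pairing_ibp hb ha ht hM' k j.
have e3 := ratio_moment_swap j k.
have e4 := pairing_mulX ha hb hM ('X^j) ('X^k).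
have fin j' k' := pairing_finite_peval hM ('X^j') ('X^k').
rewrite !(pairing_swap (fin _ _)) in e2.
rewrite -!exprS in e4.
rewrite /Phi !mulX_derivXn (scalar_formZ (Bl _)) (scalar_formZ (Br _)) !hornerXn -e4.
apply: (eq_from_combination (c := 1) (congr2 +%R (congr2 +%R e1 e2) e3)).
by ring.
Qed.

End pairing_derivative.

(** * The constraints and the rank for the given weights *)

Theorem proposition4p11 (R : realType) (a b xi psi : R[i]) (s t : R)
    (S : nat -> R[i]) (P Q : nat -> {poly R[i]})
    (ha : -1 < complex.Re a) (hb : -1 < complex.Re b)
    (hs : 0 < s) (ht : 0 < t)
    (hM : forall j k : nat,
        pairing_finite (weight xi s a) (weight psi t b)
          (@monomial R j) (@monomial R k))
    (hZ : forall n : nat, bimoment_det (weight xi s a) (weight psi t b) n != 0)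
    (hPQ : biorthogonal_polynomials (weight xi s a) (weight psi t b) S P Q)
    (hpi : forall n : nat, weight_integral (weight xi s a) (P n) != 0)
    (heta : forall n : nat, weight_integral (weight psi t b) (Q n) != 0) :
  let D := biorthogonal_data a b xi psi s t S P Q in
  [/\ (* the constraints *)
      forall n : nat,
        [/\ constraint_i D n, constraint_ii D n, constraint_iii D n,
            constraint_iv D n & constraint_v D n],
      (* (ii)-(v) give (i) by algebra alone, for arbitrary values of the
         quantities involved; X + Y = pi eta is immediate from the kernel *)
      forall (E : constraint_data R[i]) (n : nat),
        cpi E n != 0 -> ceta E n != 0 ->
        cX E n + cY E n = cpi E n * ceta E n ->
        constraint_ii E n -> constraint_iii E n ->
        constraint_iv E n -> constraint_v E n ->
        constraint_i E n
    & (* rank of (ii)-(v) in pi_(n+1), pi_(n-1), eta_(n+1), eta_(n-1) *)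
      forall n : nat,
        exists (M : 'M[R[i]]_4) (c : 'cV[R[i]]_4),
          [/\ is_linear_system D n M c,
              (\rank M <= 3)%N, (\rank (row_mx M c) <= 3)%N
            & (0 < n)%N -> \rank M = 3%N /\ \rank (row_mx M c) = 3%N]].
Proof.
move=> D; have [hS hP hQ hB] := hPQ.
have S_neq0 n : S n != 0.
  by rewrite -sqrf_eq0 hS mulf_neq0 ?invr_eq0.
have sizeP n : size (P n) = n.+1 by have [] := hP n.
have leadP n : lead_coef (P n) = S n by have [] := hP n.
have sizeQ n : size (Q n) = n.+1 by have [] := hQ n.
have leadQ n : lead_coef (Q n) = S n by have [] := hQ n.
pose B f g := pairing (weight xi s a) (weight psi t b) (peval f) (peval g).
have Bl g : scalar (B^~ g) := scalar_pairing_l hM g.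
have Br f : scalar (B f) := scalar_pairing_r hM f.
have L1 := scalar_weight_integral xi s ha.
have L2 := scalar_weight_integral psi t hb.
have C1 := scalar_cauchy_transform xi s ha ht.
have C2 := scalar_cauchy_transform psi t hb hs.
have BX f g := pairing_mulX ha hb hM f g.
have Bd f g := pairing_deriv ha hb hs ht hM f g.
have d1 f := weight_integral_ibp xi ha hs f.
have d2 g := weight_integral_ibp psi hb ht g.
have X1 f := cauchy_transformX xi s ha f ht.
have X2 g := cauchy_transformX psi t hb g hs.
have cs n := functional_constraints Bl Br L1 L2 C1 C2 S_neq0 sizeP sizeQ leadP leadQ
  hB hpi heta BX Bd d1 d2 X1 X2 n.
split=> [n|E n|n]; first exact: cs.
  exact: constraint_i_of_ii_v.
have pi0 : cpi D n != 0 := hpi n.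
have eta0 : ceta D n != 0 := heta n.
(* The actual values of the four unknowns solve the system, so the augmented matrix has the same
   rank. *)
have res0 : system_residual D n (\col_(i < 4) [:: cpi D n.+1; prev_idx (cpi D) n;
    ceta D n.+1; prev_idx (ceta D) n]`_i) = 0.
  apply/matrixP => i j; rewrite !ord1 /system_residual !mxE /=.
  have [_ h2 h3 h4 h5] := cs n.
  case: i => [[|[|[|[|i]]]] hi] //=.
  - by apply/eqP; rewrite subr_eq0; apply/eqP; exact: h2.
  - by apply/eqP; rewrite subr_eq0; apply/eqP; exact: h3.
have rk := rank_augmented res0.
exists (system_mx D n), (system_rhs D n); split.
- exact: system_mxP.
- exact: rank_system_mx_le.
- by rewrite rk; exact: rank_system_mx_le.
(* For [0 < n] the coefficient [prev_idx S n / S n] is nonzero, as the lower rank bound requires; at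
   [n = 0] it vanishes. *)
move=> n0; suff : \rank (system_mx D n) = 3%N by rewrite rk.
apply/eqP; rewrite eqn_leq rank_system_mx_le//=; apply: rank_system_mx_ge => //.
  by rewrite mulf_neq0 ?invr_eq0 ?S_neq0.
by rewrite -(prednK n0) mulf_neq0 ?invr_eq0 ?S_neq0.
Qed.
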